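(* Let $N\ge1$ be an integer and let $0<T_A<T_B<+\infty$. The invariant measure of the process on $\Omega_N=\mathbb{R}_+^{\{1,\dots,N\}}$ with generator $L_N=L_N^{\mathrm{bulk}}+L_N^{\mathrm{bound}}$ (the boundary driven integrable heat conduction model with parameter $s=1/2$; invariance of a density is expressed by the stationarity condition stated in the context) has density $$\mu_N^{T_A,T_B}(z)=\frac{1}{|O_N^{T_A,T_B}|}\int_{O_N^{T_A,T_B}}d\underline m\ \mathcal{E}_{\underline m}(z),\qquad z=(z_1,\dots,z_N),$$ where $O_N^{T_A,T_B}=\{\underline m\in\mathbb{R}^N: T_A\le m_1\le\dots\le m_N\le T_B\}$, $|O_N^{T_A,T_B}|=\frac{(T_B-T_A)^N}{N!}$ is its Lebesgue volume, and $\mathcal{E}_{\underline m}(z)=\prod_{x=1}^N\frac{1}{m_x}e^{-z_x/m_x}\mathbf{1}_{\{z_x\ge0\}}$ is the product of the densities of exponential distributions of means $m_1,\dots,m_N$.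
   Context: Let $\Lambda_N=\{1,\dots,N\}$. A configuration is $z=(z_1,\dots,z_N)\in\Omega_N=\mathbb{R}_+^{\Lambda_N}$, where $z_x$ is the energy at site $x$; $\delta_x$ denotes the configuration with $\delta_x(x)=1$ and $\delta_x(y)=0$ for $y\ne x$. The parameters $T_A,T_B$ are the temperatures of the left and right reservoirs. The generator, acting on bounded Lipschitz functions $f:\Omega_N\to\mathbb{R}$, is $L_N=L_N^{\mathrm{bulk}}+L_N^{\mathrm{bound}}$ with $$L_N^{\mathrm{bulk}}f(z)=\sum_{\substack{x,y\in\Lambda_N\\|x-y|=1}}\int_0^{z_x}\frac{d\alpha}{\alpha}\left[f(z-\alpha\delta_x+\alpha\delta_y)-f(z)\right],$$ $$L_N^{\mathrm{bound}}f(z)=\int_0^{z_1}\frac{d\alpha}{\alpha}\left[f(z-\alpha\delta_1)-f(z)\right]+\int_0^{\infty}\frac{d\alpha}{\alpha}e^{-\alpha/T_A}\left[f(z+\alpha\delta_1)-f(z)\right]$$ $$+\int_0^{z_N}\frac{d\alpha}{\alpha}\left[f(z-\alpha\delta_N)-f(z)\right]+\int_0^{\infty}\frac{d\alpha}{\alpha}e^{-\alpha/T_B}\left[f(z+\alpha\delta_N)-f(z)\right].$$ Sums over $x,y$ with $|x-y|=1$ run over ordered pairs. The stationarity condition for a probability density $\mu$ on $\mathbb{R}_+^{\Lambda_N}$ (with $\mu$ set equal to $0$ at points of $\mathbb{R}^N$ having a negative coordinate) is: for all $z\in(0,\infty)^N$, $$0=\int_0^{z_1}\frac{d\alpha}{\alpha}e^{-\alpha/T_A}\left[\mu(z-\alpha\delta_1)-\mu(z)\right]-\mu(z)\int_{z_1}^{\infty}\frac{d\alpha}{\alpha}e^{-\alpha/T_A}+\int_0^{z_1}\frac{d\alpha}{\alpha}\left[\mu(z+\alpha\delta_1)-\mu(z)\right]+\int_{z_1}^{\infty}\frac{d\alpha}{\alpha}\mu(z+\alpha\delta_1)$$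 $$+\int_0^{z_N}\frac{d\alpha}{\alpha}e^{-\alpha/T_B}\left[\mu(z-\alpha\delta_N)-\mu(z)\right]-\mu(z)\int_{z_N}^{\infty}\frac{d\alpha}{\alpha}e^{-\alpha/T_B}+\int_0^{z_N}\frac{d\alpha}{\alpha}\left[\mu(z+\alpha\delta_N)-\mu(z)\right]+\int_{z_N}^{\infty}\frac{d\alpha}{\alpha}\mu(z+\alpha\delta_N)$$ $$+\sum_{\substack{x,y\in\Lambda_N\\|x-y|=1}}\left\{\int_0^{z_x}\frac{d\alpha}{\alpha}\left[\mu(z+\alpha\delta_x-\alpha\delta_y)-\mu(z)\right]+\int_{z_x}^{\infty}\frac{d\alpha}{\alpha}\mu(z+\alpha\delta_x-\alpha\delta_y)\right\}.$$ *)

(* Defs.v *)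
From HB Require Import structures.
From mathcomp Require Import all_boot all_order all_algebra.
From mathcomp Require Import all_classical all_reals all_analysis.

Set Implicit Arguments.
Unset Strict Implicit.
Unset Printing Implicit Defensive.

Import Order.TTheory GRing.Theory Num.Theory.
Import numFieldNormedType.Exports.

Local Open Scope classical_set_scope.
Local Open Scope ring_scope.

(* [measurableTypeR R] is [R] with its Borel sigma-algebra; the library equips
   tuples over it with the product sigma-algebra, i.e. the Borel sets of R^n. *)
Notation vec R n := (n.-tuple (measurableTypeR R)).

Section lebesgue_tuple.
Context {R : realType}.

Definition vcons n (p : measurableTypeR R * vec R n) : vec R n.+1 :=
  [tuple of p.1 :: p.2].

Lemma measurable_vcons n : measurable_fun [set: _] (@vcons n).
Proof. exact: measurable_cons. Qed.

HB.instance Definition _ n :=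
  isMeasurableFun.Build _ _ _ _ (@vcons n) (@measurable_vcons n).

Section succ.
Variables (n : nat) (mu : {sigma_finite_measure set (vec R n) -> \bar R}).

Definition lebesgue_succ : set (vec R n.+1) -> \bar R :=
  pushforward (@lebesgue_measure R \x mu)%E (@vcons n).

Let lebesgue_succ0 : lebesgue_succ set0 = 0%E.
Proof. by rewrite /lebesgue_succ /pushforward preimage_set0 measure0. Qed.

Let lebesgue_succ_ge0 A : (0 <= lebesgue_succ A)%E.
Proof. exact: measure_ge0. Qed.

Let lebesgue_succ_sigma_additive : semi_sigma_additive lebesgue_succ.
Proof. exact: measure_semi_sigma_additive. Qed.

HB.instance Definition _ := isMeasure.Build _ _ _ lebesgue_succ
  lebesgue_succ0 lebesgue_succ_ge0 lebesgue_succ_sigma_additive.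

Let lebesgue_succ_sigma_finite : sigma_finite setT lebesgue_succ.
Proof.
have /sigma_finiteP[F [TF ndF Foo]] := sigma_finiteT (@lebesgue_measure R).
have /sigma_finiteP[G [TG ndG Goo]] := sigma_finiteT mu.
pose uncons (t : vec R n.+1) : measurableTypeR R * vec R n :=
  (thead t, [tuple of behead t]).
have muncons : measurable_fun setT uncons.
  apply: measurable_fun_pair; first exact: measurable_tnth.
  exact: measurable_behead.
have vconsK p : uncons (vcons p) = p.
  by case: p => x t; congr pair; apply: val_inj.
exists (fun k => uncons @^-1` (F k `*` G k)).
  apply/esym; rewrite -subTset => t _ /=.
  have [i _ Fi] : (\bigcup_i F i) (uncons t).1 by rewrite -TF.
  have [j _ Gj] : (\bigcup_i G i) (uncons t).2 by rewrite -TG.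
  exists (maxn i j) => //; split => /=.
    by move: Fi; exact/subsetPset/ndF/leq_maxl.
  by move: Gj; exact/subsetPset/ndG/leq_maxr.
move=> k; have [mF Fk] := Foo k; have [mG Gk] := Goo k; split.
  by rewrite -[X in measurable X]setTI; apply: muncons => //; exact: measurableX.
rewrite /lebesgue_succ /pushforward.
rewrite (_ : _ @^-1` _ = F k `*` G k); last first.
  by apply/seteqP; split => p; rewrite /preimage /mkset vconsK.
by rewrite product_measure1E// lte_mul_pinfty// ge0_fin_numE.
Qed.

HB.instance Definition _ := Measure_isSigmaFinite.Build _ _ _ lebesgue_succ
  lebesgue_succ_sigma_finite.

End succ.

(* Lebesgue measure on R^n: the n-fold product of Lebesgue measure on R, the
   unit point mass for n = 0; see lebesgue_tuple_box. *)
Fixpoint lebesgue_tuple n : {sigma_finite_measure set (vec R n) -> \bar R} :=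
  match n with
  | 0 => \d_([tuple] : vec R 0)
  | n'.+1 => lebesgue_succ (lebesgue_tuple n')
  end.

Lemma lebesgue_tuple_box n (A : 'I_n -> set (measurableTypeR R)) :
  (forall i, measurable (A i)) ->
  lebesgue_tuple n [set t | forall i, A i (tnth t i)] =
  (\prod_(i < n) lebesgue_measure (A i))%E.
Proof.
elim: n A => [|n IHn] A mA.
  by rewrite big_ord0 /= /dirac indicE mem_set//= => -[].
have mbox (B : 'I_n -> set (measurableTypeR R)) : (forall i, measurable (B i)) ->
    measurable [set t : vec R n | forall i, B i (tnth t i)].
  move=> mB; rewrite (_ : [set _ | _] =
    \bigcap_(i in [set: 'I_n]) ((fun t : vec R n => tnth t i) @^-1` B i)).
    apply: fin_bigcap_measurable => // i _.
    by rewrite -[X in measurable X]setTI; exact: measurable_tnth.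
  apply/seteqP; split=> [t h i _|t h i]; first exact: h.
  by have /(_ Logic.I) := h i.
rewrite big_ord_recl -IHn// -product_measure1E//; last first.
  exact: (mbox (fun i => A (lift ord0 i))).
rewrite /= /lebesgue_succ /pushforward; congr product_measure1.
apply/seteqP; split => -[x t] /=; rewrite /preimage /mkset /=.
  by move=> h; split => /= [|i]; [have := h ord0|have := h (lift ord0 i); rewrite tnthS].
by move=> [/= h0 h] i; case: (unliftP ord0 i) => [j ->|-> //]; rewrite tnthS.
Qed.

End lebesgue_tuple.

Section model.
Context {R : realType}.
Local Notation leb := (@lebesgue_measure R).

(* z + a delta_x *)
Definition add_at n (z : vec R n) (x : 'I_n) (a : R) : vec R n :=
  [tuple (tnth z y : R) + a *+ (y == x) | y < n].

(* A zero-extended probability density on R_+^n. *)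
Definition is_density n (mu : vec R n -> R) : Prop :=
  [/\ measurable_fun setT mu,
      forall z, 0 <= mu z,
      forall z, (exists x, (tnth z x : R) < 0) -> mu z = 0 &
      (\int[lebesgue_tuple n]_z (mu z)%:E = 1)%E].

(* The integrals below are extended-real Lebesgue integrals
   [\int f = \int f^+ - \int f^-], and in [\bar R] a sum with an infinite term is
   infinite. For measurable mu, the equation [stationary] therefore entails that
   each of its integrals converges absolutely. *)
Section stationarity.
Local Open Scope ereal_scope.

Definition reservoir_term n (T : R) (x : 'I_n) (mu : vec R n -> R)
    (z : vec R n) : \bar R :=
  let zx : R := tnth z x in
  \int[leb]_(a in `]0%R, zx])
      (a^-1 * expR (- a / T) * (mu (add_at z x (- a)) - mu z))%:E
  - (mu z)%:E * \int[leb]_(a in `[zx, +oo[) (a^-1 * expR (- a / T))%:E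
  + \int[leb]_(a in `]0%R, zx]) (a^-1 * (mu (add_at z x a) - mu z))%:E
  + \int[leb]_(a in `[zx, +oo[) (a^-1 * mu (add_at z x a))%:E.

Definition bulk_term n (x y : 'I_n) (mu : vec R n -> R) (z : vec R n) : \bar R :=
  let zx : R := tnth z x in
  \int[leb]_(a in `]0%R, zx])
      (a^-1 * (mu (add_at (add_at z x a) y (- a)) - mu z))%:E
  + \int[leb]_(a in `[zx, +oo[)
      (a^-1 * mu (add_at (add_at z x a) y (- a)))%:E.

Definition neighbours n (x y : 'I_n) : bool := (`|x%:Z - y%:Z| == 1)%R.

(* The sites 1, ..., N with N = n.+1 are numbered from 0, so that [ord0] and
   [ord_max] are the ones in contact with the reservoirs. *)
Definition stationary n (TA TB : R) (mu : vec R n.+1 -> R) : Prop :=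
  forall z : vec R n.+1, (forall x, (0 < (tnth z x : R))%R) ->
  0 = reservoir_term TA ord0 mu z
      + reservoir_term TB ord_max mu z
      + \sum_(x < n.+1) \sum_(y < n.+1 | neighbours x y) bulk_term x y mu z.

End stationarity.

Definition ordered_means n (TA TB : R) : set (vec R n) :=
  [set m | (forall x, TA <= (tnth m x : R) <= TB) /\
           (forall x y : 'I_n, (x <= y)%N -> (tnth m x : R) <= tnth m y)].
Arguments ordered_means : clear implicits.

Definition exponential_product n (m z : vec R n) : R :=
  \prod_(x < n) exponential_pdf (tnth m x : R)^-1 (tnth z x).

Lemma exponential_pdfVE (m z : R) :
  exponential_pdf m^-1 z = if 0 <= z then m^-1 * expR (- z / m) else 0.
Proof.
rewrite /exponential_pdf patchE mem_setE in_itv/= andbT.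
by case: ifP => // _; rewrite !mulNr [m^-1 * z]mulrC.
Qed.

Definition mixture_density n (TA TB : R) (z : vec R n) : R :=
  (fine (lebesgue_tuple n (ordered_means n TA TB)))^-1 *
  \int[lebesgue_tuple n]_(m in ordered_means n TA TB) exponential_product m z.

End model.
Arguments ordered_means {R} n TA TB.
Arguments mixture_density {R} n TA TB z.

(* Main.v *)
(** With [E_m = exponential_product m], the adjoint generator applied to [E_m]
    is [E_m] times a sum over bonds. A bond between a site of energy [z] and
    mean [m] and a neighbour (or reservoir) of mean [c] contributes
    [W(z,c,m) = \int_0^oo (1_{a<=z} e^{a/m} - 1) (e^{-a/c} - e^{-a/m}) da/a],
    up to terms that are antisymmetric in the two ends of the bond.
    For [a <= b] one has
    [\int_a^b m^-1 e^{-z/m} (W(z,a,m) + W(z,b,m)) dm = 0]: writing the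
    differences of exponentials as integrals of their derivative in the
    temperature [u], the left-hand side becomes the integral over [[a,b]^2] of
    [sgn(u - m) (e_u(z) - e_m(z)) / (u - m)], where [e_m(z) = m^-1 e^{-z/m}], and
    this is antisymmetric in [(u,m)]. Integrating [m_x] between its two
    neighbours [m_{x-1}] and [m_{x+1}] inside the ordered simplex therefore kills
    the contribution of the two bonds of each site [x] separately. *)
Require Import Defs.
From mathcomp Require Import all_boot all_order all_algebra.
From mathcomp Require Import all_classical all_reals all_analysis.
From mathcomp Require Import measurable_realfun ring lra zify.

Set Implicit Arguments.
Unset Strict Implicit.
Unset Printing Implicit Defensive.

Import Order.TTheory GRing.Theory Num.Theory.
Import numFieldNormedType.Exports.

Local Open Scope classical_set_scope.
Local Open Scope ring_scope.

(** * Dominated integrals over products *)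

(** The brackets of the generator cannot be split, since da/a diverges at 0. Grouped as in [W], the
    integrand is dominated by a multiple of e^{-a/B}, uniformly over all means and temperatures in
    [A, B] with A > 0. This one bound justifies exchanging the integral over the jump size with the
    integral over the simplex, and with the integral over the temperature u. For a fixed vector of
    means the bond sum does not vanish in general; the integral over m_x is needed. The domain
    supplies exactly the right limits: with the other means fixed, m_x ranges between the means of
    its neighbours, the reservoirs acting as m_0 = T_A and m_{N+1} = T_B. The -1 inside [W] is what
    makes the divided difference of e_m symmetric: the part of the jump integral up to z, taken
    alone, gives (e^{-z/u} - e^{-z/m}) / (u (u - m)), which is not symmetric in (u, m). *)

Section general.
Context {R : realType}.

Lemma measurable_inv : measurable_fun [set: R] (fun x : R => x^-1).
Proof.
have -> : (fun x : R => x^-1) = (fun x : R => if x == 0 then 0 else x^-1).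
  by apply/funext => x; case: ifP => // /eqP ->; rewrite invr0.
apply: measurable_fun_if => //.
  by apply: (measurable_fun_bool true); rewrite setTI (_ : _ @^-1` _ = [set 0])//;
    apply/seteqP; split => x /=; rewrite /preimage /=; [move/eqP|move=> ->; rewrite eqxx].
apply: open_continuous_measurable_fun.
  rewrite setTI (_ : _ @^-1` _ = ~` [set 0]); first by apply: closed_openC; exact: closed_eq.
  by apply/seteqP; split => x /=; rewrite /preimage /=; [move/negbT/eqP|move=> /eqP/negbTE].
move=> x; rewrite setTI inE /= => /negbT x0; exact: inv_continuous.
Qed.

Lemma measurable_funV d (T : measurableType d) (D : set T) (f : T -> R) :
  measurable_fun D f -> measurable_fun D (fun x => (f x)^-1).
Proof. by move=> mf; apply: measurableT_comp => //; exact: measurable_inv. Qed.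

Lemma measurable_ler_indic d (T : measurableType d) (f g : T -> R) :
  measurable_fun setT f -> measurable_fun setT g ->
  measurable_fun setT (fun x => (f x <= g x)%R%:R : R).
Proof.
move=> mf mg.
rewrite (_ : (fun _ => _) = fun x => if (f x <= g x)%R then 1 else 0); last first.
  by apply/funext => x; case: ifP.
by apply: measurable_fun_ifT => //; exact: measurable_fun_ler.
Qed.

Section dom.
Context d (T : measurableType d) (mu : {measure set T -> \bar R}).

Lemma dominated_integrable (D : set T) (f g : T -> R) :
  measurable D -> measurable_fun D f -> mu.-integrable D (EFin \o g) ->
  (forall x, D x -> `|f x| <= g x) -> mu.-integrable D (EFin \o f).
Proof.
move=> mD mf ig fg; apply: (le_integrable mD _ _ ig).
  exact/measurable_EFinP.
by move=> x Dx /=; rewrite lee_fin (le_trans (fg _ Dx))// ler_norm.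
Qed.

Lemma bounded_integrable (D : set T) (f : T -> R) (C : R) :
  measurable D -> (mu D < +oo)%E -> measurable_fun D f ->
  (forall x, D x -> `|f x| <= C) -> mu.-integrable D (EFin \o f).
Proof.
move=> mD Doo mf fC; apply: (@dominated_integrable _ _ (cst C)) => //.
apply/integrableP; split; first exact/measurable_EFinP.
under eq_integral do rewrite /=.
by rewrite integral_cst//= lte_mul_pinfty.
Qed.

Lemma EFin_Rintegral (D : set T) (f : T -> R) : measurable D -> mu.-integrable D (EFin \o f) ->
  (\int[mu]_(a in D) (f a)%:E = (\int[mu]_(a in D) f a)%R%:E)%E.
Proof.
by move=> mD fi; rewrite /Rintegral fineK//; exact: integrable_fin_num.
Qed.

End dom.

Section fubini.
Context d1 d2 (T1 : measurableType d1) (T2 : measurableType d2).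
Variable m2 : {sigma_finite_measure set T2 -> \bar R}.

(** No integrability is required: the partial integrals of the positive and negative parts are
    measurable by Tonelli, and [fine] of their difference is measurable even where that difference
    is infinite. Hence [bond_rate] is measurable on all real means, not only on positive ones. *)
Lemma measurable_Rintegral (D2 : set T2) (f : T1 * T2 -> R) :
  measurable D2 -> measurable_fun setT f ->
  measurable_fun setT (fun x => \int[m2]_(y in D2) f (x, y)).
Proof.
move=> mD2 mf.
pose F (z : (T1 * T2)%type) := (f z * \1_D2 z.2)%:E.
have mF : measurable_fun [set: (T1 * T2)%type] F.
  apply/measurable_EFinP; apply: measurable_funM => //.
  by apply: measurableT_comp => //; exact: measurable_indic.
rewrite (_ : (fun x => _) = fine \o (fun x => \int[m2]_y F (x, y))%E); last first.
  apply/funext => x /=; rewrite Rintegral_mkcond /Rintegral; congr fine.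
  apply: eq_integral => y _ /=; rewrite /F /= patchE indicE.
  by case: (y \in D2); rewrite ?mulr1 ?mulr0.
apply: measurableT_comp => //.
rewrite (_ : (fun x => _) =
    (fun x => (\int[m2]_y F^\+ (x, y) - \int[m2]_y F^\- (x, y))%E)).
  apply: emeasurable_funB.
    by apply: measurable_fun_fubini_tonelli_F => //; exact: measurable_funepos.
  by apply: measurable_fun_fubini_tonelli_F => //; exact: measurable_funeneg.
apply/funext => x; rewrite integralE; congr (_ - _)%E; apply: eq_integral => y _.
  by rewrite funepos_comp.
by rewrite funeneg_comp.
Qed.

Variable m1 : {sigma_finite_measure set T1 -> \bar R}.
Variables (D1 : set T1) (D2 : set T2) (f : T1 -> T2 -> R) (g : T1 -> R).
Hypotheses (mD1 : measurable D1) (mD2 : measurable D2) (D2oo : (m2 D2 < +oo)%E).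
Hypothesis mf : measurable_fun setT (fun z => f z.1 z.2).
Hypothesis ig : m1.-integrable D1 (EFin \o g).
Hypothesis fg : forall x y, D1 x -> D2 y -> `|f x y| <= g x.

Let F z := (f z.1 z.2 * \1_D1 z.1 * \1_D2 z.2).

Let mF : measurable_fun setT F.
Proof.
apply: measurable_funM; first apply: measurable_funM => //.
  by apply: measurableT_comp => //; exact: measurable_indic.
by apply: measurableT_comp => //; exact: measurable_indic.
Qed.

(** By Tonelli, the integral of |F| is at most [m2 D2] times that of |g|. A dominating function of
    the first variable alone suffices because [D2] has finite mass. Typically the first variable is
    the jump size on the half-line, and the second a temperature or a point of the simplex. *)
Lemma dominated_integrable_prod : (m1 \x m2)%E.-integrable setT (EFin \o F).
Proof.
apply/integrable12ltyP; first exact/measurable_EFinP.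
apply: (@le_lt_trans _ _ (\int[m1]_x ((`|g x| * \1_D1 x)%:E * m2 D2)%E)%E).
  apply: ge0_le_integral => //.
  - move=> x _; exact: integral_ge0.
  - apply: (measurable_fun_fubini_tonelli_F (abse \o (EFin \o F))) => //=.
    by apply: measurableT_comp => //; exact/measurable_EFinP.
  - apply: emeasurable_funM => //; apply/measurable_EFinP.
    rewrite (_ : (fun _ => _) = Num.norm \o (g \_ D1)); last first.
      apply/funext => x /=; rewrite patchE indicE; case: (x \in D1).
        by rewrite mulr1.
      by rewrite mulr0 normr0.
    apply: measurableT_comp => //.
    apply/(measurable_restrictT _ mD1); apply/measurable_EFinP.
    by case/integrableP : ig.
  move=> x _; rewrite -(integral_cst m2 mD2) [leRHS]integral_mkcond.
  apply: ge0_le_integral => //.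
  - apply: measurableT_comp => //; apply/measurable_EFinP.
    exact: (measurable_fun_pair2 x mF).
  - apply/(measurable_restrictT _ mD2) => //.
  - move=> y _; rewrite patchE /F /= !indicE.
    case: ifPn => yD; last by rewrite mulr0 normr0.
    rewrite mulr1 lee_fin normrM; case: (boolP (x \in D1)) => xD.
      by rewrite normr1 !mulr1 (le_trans (fg _ _))// ?ler_norm//; exact: set_mem.
    by rewrite normr0 !mulr0.
have [_] := integrableP _ _ _ ig => igoo.
rewrite ge0_integralZr//.
- rewrite lte_mul_pinfty//.
  + exact: integral_ge0.
  + rewrite ge0_fin_numE; last exact: integral_ge0.
    move: igoo; rewrite [X in (X < _)%E -> _]integral_mkcond; apply: le_lt_trans.
    rewrite le_eqVlt; apply/orP; left; apply/eqP; apply: eq_integral => x _.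
    by rewrite patchE indicE; case: ifP => _; rewrite ?mulr1 ?mulr0.
- apply/measurable_EFinP.
  rewrite (_ : (fun _ => _) = Num.norm \o (g \_ D1)); last first.
    apply/funext => x /=; rewrite patchE indicE; case: (x \in D1).
      by rewrite mulr1.
    by rewrite mulr0 normr0.
  apply: measurableT_comp => //.
  apply/(measurable_restrictT _ mD1); apply/measurable_EFinP.
  by case/integrableP : ig.
Qed.

Let FE x y : (F (x, y))%:E = ((fun x => ((fun y => (f x y)%:E) \_ D2) y) \_ D1) x.
Proof.
rewrite /F !patchE /= !indicE; case: (x \in D1); case: (y \in D2);
  by rewrite ?(mulr1, mulr0).
Qed.

Lemma integrable_section1 x : D1 x -> m2.-integrable D2 (EFin \o f x).
Proof.
move=> D1x; apply: (@bounded_integrable _ _ m2 D2 _ (g x)) => //.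
  by apply: measurable_funTS; exact: (measurable_fun_pair2 x mf).
by move=> y D2y; exact: fg.
Qed.

Lemma integrable_section2 y : D2 y -> m1.-integrable D1 (EFin \o f ^~ y).
Proof.
move=> D2y; apply: (@dominated_integrable _ _ m1 D1 _ g) => //.
  by apply: measurable_funTS; exact: (measurable_fun_pair1 y mf).
by move=> x D1x; exact: fg.
Qed.

Lemma Rintegral12E : \int[m1]_(x in D1) \int[m2]_(y in D2) f x y =
  \int[(m1 \x m2)%E]_z F z.
Proof.
rewrite /Rintegral; congr fine.
rewrite -(integral12_prod_meas1 dominated_integrable_prod) integral_mkcond.
apply: eq_integral => x _; rewrite patchE /fubini_F; case: ifPn => xD1; last first.
  under eq_integral do rewrite /= FE patchE (negbTE xD1).
  by rewrite integral0.
under [RHS]eq_integral do rewrite /= FE patchE xD1.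
rewrite -integral_mkcond fineK//; apply: integrable_fin_num => //.
by apply: integrable_section1; exact: set_mem.
Qed.

Lemma Rintegral21E : \int[m2]_(y in D2) \int[m1]_(x in D1) f x y =
  \int[(m1 \x m2)%E]_z F z.
Proof.
rewrite /Rintegral; congr fine.
rewrite -(integral21_prod_meas1 dominated_integrable_prod) integral_mkcond.
apply: eq_integral => y _; rewrite patchE /fubini_G; case: ifPn => yD2; last first.
  under eq_integral do rewrite /= FE !patchE (negbTE yD2) if_same.
  by rewrite integral0.
under [RHS]eq_integral => x _.
  rewrite /= FE (_ : _ x = ((fun x => (f x y)%:E) \_ D1) x); last first.
    by rewrite !patchE yD2.
  over.
rewrite -integral_mkcond fineK//; apply: integrable_fin_num => //.
by apply: integrable_section2; exact: set_mem.
Qed.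

Lemma Rfubini : \int[m1]_(x in D1) \int[m2]_(y in D2) f x y =
  \int[m2]_(y in D2) \int[m1]_(x in D1) f x y.
Proof. by rewrite Rintegral12E Rintegral21E. Qed.

Lemma integrable_Rintegral2 :
  m1.-integrable D1 (EFin \o (fun x => \int[m2]_(y in D2) f x y)).
Proof.
apply: (@dominated_integrable _ _ m1 D1 _ (fun x => fine (m2 D2) * g x)) => //.
- apply: measurable_funTS.
  exact: (@measurable_Rintegral D2 (fun z => f z.1 z.2)).
- exact: (integrableZl mD1 (fine (m2 D2)) ig).
move=> x D1x.
apply: (le_trans (le_normr_Rintegral mD2 (integrable_section1 D1x))).
rewrite mulrC -(Rintegral_cst m2 mD2 (g x)); apply: le_Rintegral => //.
- exact: integrable_norm (integrable_section1 D1x).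
- exact: (@bounded_integrable _ _ m2 D2 _ `|g x|).
- by move=> y D2y; exact: fg.
Qed.

End fubini.
End general.

#[local] Instance is_derive_pow (R : realType) (f : R -> R) (n : nat) (x df : R) :
  is_derive x 1 f df ->
  is_derive x 1 (fun y => f y ^+ n) ((n%:R * f x ^+ n.-1) *: df).
Proof.
move=> dfx; rewrite (_ : (fun y => _) = f ^+ n); first exact: is_deriveX.
by apply/funext => y; rewrite exprfctE.
Qed.

(** * The ordered simplex *)

Section simplex.
Context {R : realType}.
Local Notation leb := (@lebesgue_measure R).
Lemma derivable_continuous (f : R -> R) (x : R) :
  derivable f x 1 -> {for x, continuous f}.
Proof. by move=> dfx; apply: differentiable_continuous; exact/derivable1_diffP. Qed.

(** The degenerate interval is included because its end points will be means of neighbouring sites,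
    which may coincide. *)
Lemma FTC2_closed (f F : R -> R) (a b : R) : a <= b ->
  (forall x, a <= x <= b -> {for x, continuous f}) ->
  (forall x, a <= x <= b -> is_derive x 1 F (f x)) ->
  (\int[leb]_(x in `[a, b]) (f x)%:E = (F b - F a)%:E)%E.
Proof.
rewrite le_eqVlt => /predU1P[<- _ _|ab cf dF].
  by rewrite set_itv1 integral_set1 subrr.
have cF x : a <= x <= b -> {for x, continuous F}.
  by move=> /dF dFx; apply: derivable_continuous; exact: ex_derive.
rewrite EFinB; apply: continuous_FTC2 => //.
- by apply: continuous_in_subspaceT => x; rewrite inE /= in_itv /=; exact: cf.
- split.
  + move=> x; rewrite in_itv/= => /andP[ax xb].
    by have := dF x; rewrite !ltW// => /(_ isT) ?; exact: ex_derive.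
  + by apply: cvg_at_right_filter; apply: cF; rewrite lexx ltW.
  + by apply: cvg_at_left_filter; apply: cF; rewrite lexx ltW.
- move=> x; rewrite in_itv/= => /andP[ax xb].
  by have := dF x; rewrite !ltW// => /(_ isT) ?; rewrite derive1E; exact: derive_val.
Qed.

Lemma measurable_nth n (b : R) i :
  measurable_fun [set: vec R n] (fun t => nth b t i).
Proof.
have [ni|ni] := leqP n i.
  rewrite (_ : (fun _ => _) = cst b)//.
  by apply/funext => t; rewrite nth_default// size_tuple.
rewrite (_ : (fun _ => _) = (fun t : vec R n => tnth t (Ordinal ni) : R)).
  exact: measurable_tnth.
by apply/funext => t; rewrite (tnth_nth b).
Qed.

Lemma measurable_ordered_means n (a b : R) : measurable (ordered_means n a b).
Proof.
have mle (f g : vec R n -> R) : measurable_fun setT f -> measurable_fun setT g ->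
    measurable [set t | f t <= g t].
  move=> mf mg; rewrite -[X in measurable X]setTI.
  exact: (measurable_fun_ler mf mg measurableT (Y := [set true])).
have mt (i : 'I_n) : measurable_fun setT (fun t : vec R n => tnth t i : R).
  exact: measurable_tnth.
rewrite (_ : ordered_means n a b =
  (\bigcap_(i in [set: 'I_n]) ([set t | a <= (tnth t i : R)] `&` [set t | (tnth t i : R) <= b]))
  `&` (\bigcap_(i in [set: 'I_n]) \bigcap_(j in [set j : 'I_n | (i <= j)%N])
    [set t | (tnth t i : R) <= tnth t j])).
  apply: measurableI.
    by apply: fin_bigcap_measurable => // i _; apply: measurableI; exact: mle.
  apply: fin_bigcap_measurable => // i _.
  by apply: fin_bigcap_measurable => // j _; exact: mle.
apply/seteqP; split => t [h1 h2]; split.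
- by move=> i _; have /andP[] := h1 i.
- by move=> i _ j ij; exact: h2.
- by move=> i; have [] := h1 i I => ? ?; apply/andP.
- by move=> i j ij; exact: (h2 i I j ij).
Qed.

Lemma ordered_means_vcons n (a b x : R) (t : vec R n) :
  ordered_means n.+1 a b (vcons (x, t)) <-> a <= x <= b /\ ordered_means n x b t.
Proof.
split.
  move=> [h1 h2]; split; first exact: (h1 ord0).
  split.
    move=> i; have := h2 ord0 (lift ord0 i) isT.
    have := h1 (lift ord0 i); rewrite tnthS => /andP[_ ->].
    by rewrite andbT.
  move=> i j ij; have := h2 (lift ord0 i) (lift ord0 j).
  by rewrite !tnthS; apply.
move=> [/andP[ax xb] [h1 h2]]; split.
  move=> i; case: (unliftP ord0 i) => [j ->|->].
    by rewrite tnthS; have /andP[xj ->] := h1 j; rewrite (le_trans ax).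
  by rewrite /= ax xb.
move=> i j; case: (unliftP ord0 i) => [i' ->|->]; case: (unliftP ord0 j) => [j' ->|->] //.
  by rewrite !tnthS; exact: h2.
by rewrite tnthS => _; have /andP[] := h1 j'.
Qed.

(** Prepares for integrating the first mean innermost: the only upper constraint on [x] comes from
    the next mean. For an empty tuple [head b t] is [b], so the right reservoir takes over as the
    next mean. *)
Lemma ordered_means_head n (a b x : R) (t : vec R n) : a <= x -> x <= b ->
  ordered_means n x b t <-> ordered_means n a b t /\ x <= head b t.
Proof.
move=> ax xb; split.
  move=> [h1 h2]; split.
    split=> // i; have /andP[xt ->] := h1 i.
    by rewrite (le_trans ax).
  case: n t h1 {h2} => [|n] t h1; first by rewrite tuple0.
  by rewrite -nth0 -(tnth_nth b t ord0); have /andP[] := h1 ord0.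
move=> [[h1 h2] xt]; split=> // i; have /andP[_ ->] := h1 i; rewrite andbT.
apply: (le_trans xt); case: n t i {h1 xt} h2 => [|n] t i h2; first by case: i.
by rewrite -nth0 -(tnth_nth b t ord0); exact: h2.
Qed.

(** Slicing at the first mean x leaves the simplex over [x, b] in one dimension less, so the volume
    is the integral of (b - x)^n / n! over [a, b]. *)
Lemma lebesgue_ordered_means n (a b : R) : a <= b ->
  lebesgue_tuple n (ordered_means n a b) = ((b - a) ^+ n / n`!%:R)%:E.
Proof.
elim: n a => [|n IHn] a ab.
  rewrite /= /dirac indicE mem_set/=; first by rewrite expr0 fact0 divr1.
  by split => -[].
rewrite /= /lebesgue_succ /pushforward /product_measure1.
transitivity (\int[leb]_(x in `[a, b]) ((b - x) ^+ n / n`!%:R)%:E)%E.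
  rewrite [RHS]integral_mkcond; apply: eq_integral => x _ /=.
  rewrite patchE mem_setE in_itv/=; case: ifPn => axb.
    rewrite -IHn; last by have /andP[] := axb.
    congr (lebesgue_tuple n _); apply/seteqP; split => t; rewrite /xsection /= inE.
      by move=> /ordered_means_vcons[].
    by move=> h; apply/ordered_means_vcons.
  rewrite (_ : xsection _ _ = set0) ?measure0//.
  apply/seteqP; split => // t; rewrite /xsection /= inE => /ordered_means_vcons[].
  by rewrite (negbTE axb).
have cf (x : R) : {for x, continuous (fun x : R => (b - x) ^+ n / n`!%:R)}.
  apply: differentiable_continuous.
  by apply/derivable1_diffP; apply: ex_derive.
apply: etrans.
  apply: (@FTC2_closed _ (fun x => - ((b - x) ^+ n.+1 / n.+1`!%:R))) => //.
  - move=> x _; apply: is_derive_eq.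
    rewrite /GRing.scale /=.
    rewrite factS natrM; field.
    by rewrite -(natrD _ 1 n) !pnatr_eq0 -lt0n fact_gt0.
by rewrite /= subrr expr0n /= mul0r oppr0 sub0r opprK.
Qed.

Lemma ordered_means_fin n (a b : R) : (lebesgue_tuple n (ordered_means n a b) < +oo)%E.
Proof.
have [ab|ba] := leP a b; first by rewrite lebesgue_ordered_means// ltry.
case: n => [|n].
  by rewrite /= /dirac indicE ltry.
rewrite (_ : ordered_means _ _ _ = set0) ?measure0//.
apply/seteqP; split => // t [/(_ ord0)/andP[h1 h2] _].
by have := le_lt_trans (le_trans h1 h2) ba; rewrite ltxx.
Qed.

Lemma ge0_integral_tupleS n (f : vec R n.+1 -> \bar R) :
  measurable_fun setT f -> (forall t, 0 <= f t)%E ->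
  (\int[lebesgue_tuple n.+1]_t f t =
   \int[leb]_x \int[lebesgue_tuple n]_t f (vcons (x, t)))%E.
Proof.
move=> mf f0.
transitivity (\int[(leb \x lebesgue_tuple n)]_p (f \o @vcons R n) p)%E.
  rewrite -(@ge0_integral_pushforward _ _ _ _ _ (@vcons R n) (@measurable_vcons R n) _ setT)//.
apply: fubini_tonelli1 => [|p]; last exact: f0.
apply: (measurableT_comp mf).
exact: measurable_vcons.
Qed.

(** * Integration over the simplex with the first mean outermost or innermost *)

Section peel.
Variables (n : nat) (a b C : R) (F : vec R n.+1 -> R).
Hypothesis mF : measurable_fun setT F.
Hypothesis FC : forall t, ordered_means n.+1 a b t -> `|F t| <= C.

(** The simplex is the part of [a, b] times [ordered_means n a b] where x <= [head b t]. Moving this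
    constraint into the integrand leaves a product domain, where the order of integration is
    free. *)
Let f (x : measurableTypeR R) (t : vec R n) : R := F (vcons (x, t)) * ((x : R) <= head b t)%R%:R.

Let mf : measurable_fun setT (fun z => f z.1 z.2).
Proof.
apply: measurable_funM.
  by apply: measurableT_comp => //; exact: measurable_vcons.
apply: measurable_ler_indic; first exact: measurable_fst.
rewrite (_ : (fun _ => _) = (fun t : vec R n => nth b t 0) \o snd); last first.
  by apply/funext => -[x t] /=; rewrite nth0.
by apply: measurableT_comp => //; exact: measurable_nth.
Qed.

Let fC (x : measurableTypeR R) t : `[a, b]%classic x -> ordered_means n a b t ->
  `|f x t| <= cst C x.
Proof.
rewrite /= in_itv/= => /andP[ax xb] ot; rewrite /f normrM.
have C0 : 0 <= C.
  (* [FC] yields C >= 0 only through a point of the simplex; the constant tuple [b] is one, since a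
     <= x <= b. *)
  apply: le_trans (FC (t := vcons (b, nseq_tuple n b)) _) => //.
  apply/ordered_means_vcons; split; first by rewrite lexx andbT (le_trans ax).
  by split => [i|i j _]; rewrite !tnth_nseq lexx.
case: (boolP (x <= head b t)) => xt; last by rewrite normr0 mulr0.
rewrite normr1 mulr1; apply: FC; apply/ordered_means_vcons.
by split; [rewrite ax|apply/(ordered_means_head t ax xb)].
Qed.

Let ig : leb.-integrable `[a, b] (EFin \o cst C).
Proof.
apply: (@bounded_integrable _ _ _ _ _ _ `|C|) => //.
by rewrite /= lebesgue_measure_itv /=; case: ifP => _; rewrite ?ltry.
Qed.

Let mab : measurable (`[a, b]%classic : set (measurableTypeR R)).
Proof. exact: measurable_itv. Qed.

Let prodE : \int[lebesgue_tuple n.+1]_(t in ordered_means n.+1 a b) F t =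
  \int[(leb \x lebesgue_tuple n)%E]_z
    (f z.1 z.2 * \1_(`[a, b]%classic) z.1 * \1_(ordered_means n a b) z.2).
Proof.
rewrite Rintegral_mkcond /Rintegral; congr fine.
set G := F \_ _.
have mG : measurable_fun setT G.
  by apply/(measurable_restrictT _ (@measurable_ordered_means n.+1 a b)); exact: measurable_funTS.
have FE z : G (vcons z) = f z.1 z.2 * \1_(`[a, b]%classic) z.1 * \1_(ordered_means n a b) z.2.
  case: z => x t; rewrite /G patchE !indicE /f /= mem_setE in_itv/=.
  case: ifPn => [/set_mem/ordered_means_vcons[axb]|].
    have /andP[ax xb] := axb.
    by move=> /(ordered_means_head t ax xb)[/mem_set -> ->]; rewrite axb !mulr1.
  case: (boolP (a <= x <= b)) => [axb|_ _]; last by rewrite mulr0 mul0r.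
  have /andP[ax xb] := axb.
  case: (boolP (x <= _)) => [xt|_ _]; last by rewrite mulr0 !mul0r.
  case: (boolP (t \in _)) => [/set_mem ot|_ _]; last by rewrite mulr0.
  case/negP; apply/mem_set/ordered_means_vcons; split => //.
  by apply/(ordered_means_head t ax xb).
transitivity (\int[(leb \x lebesgue_tuple n)]_z (EFin \o G \o @vcons R n) z)%E.
  apply: (integral_pushforward (@measurable_vcons R n)) => //.
    exact/measurable_EFinP.
  rewrite (_ : _ \o _ = EFin \o (fun z => f z.1 z.2 *
      \1_(`[a, b]%classic) z.1 * \1_(ordered_means n a b) z.2)); last first.
    by apply/funext => z /=; rewrite FE.
  exact: (dominated_integrable_prod _ (@measurable_ordered_means n a b)
    (@ordered_means_fin n a b) mf ig fC).
by apply: eq_integral => z _ /=; rewrite FE.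
Qed.

Lemma Rintegral_ordered_means12 : \int[lebesgue_tuple n.+1]_(t in ordered_means n.+1 a b) F t =
  \int[leb]_(x in `[a, b]) \int[lebesgue_tuple n]_(t in ordered_means n x b) F (vcons (x, t)).
Proof.
apply: etrans (etrans prodE (esym (Rintegral12E mab
  (@measurable_ordered_means n a b) (@ordered_means_fin n a b) mf ig fC))) _.
apply: eq_Rintegral => x; rewrite mem_setE in_itv/= => /andP[ax xb].
rewrite Rintegral_mkcond [RHS]Rintegral_mkcond; congr Rintegral; apply/funext => t.
rewrite !patchE /f.
case: ifPn => [/set_mem ot|/negP ot].
  case: (boolP (x <= _)) => xt.
    by rewrite mulr1 ifT//; apply/mem_set/(ordered_means_head t ax xb).
  rewrite mulr0 ifF//; apply/negP => /set_mem /(ordered_means_head t ax xb)[_].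
  by rewrite (negbTE xt).
by rewrite ifF//; apply/negP => /set_mem /(ordered_means_head t ax xb)[/mem_set].
Qed.

Lemma Rintegral_ordered_means21 : \int[lebesgue_tuple n.+1]_(t in ordered_means n.+1 a b) F t =
  \int[lebesgue_tuple n]_(t in ordered_means n a b)
    \int[leb]_(x in `[a, head b t]) F (vcons (x, t)).
Proof.
apply: etrans (etrans prodE (esym (Rintegral21E mab
  (@measurable_ordered_means n a b) (@ordered_means_fin n a b) mf ig fC))) _.
apply: eq_Rintegral => t /set_mem ot.
have tb : head b t <= b.
  case: (n) t ot => [|k] t [h _]; first by rewrite tuple0.
  by rewrite -nth0 -(tnth_nth b t ord0); have /andP[] := h ord0.
rewrite Rintegral_mkcond [RHS]Rintegral_mkcond; congr Rintegral; apply/funext => x.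
rewrite !patchE /f !mem_setE !in_itv/=.
case: (boolP (x <= head b t)) => xt; last by rewrite mulr0 andbF if_same.
by rewrite mulr1 (le_trans xt tb).
Qed.

End peel.
End simplex.

Ltac measurability := repeat first
  [ exact: measurable_fst | exact: measurable_snd | exact: measurable_cst
  | exact: measurable_id | assumption
  | apply: measurable_funM | apply: measurable_funB | apply: measurable_funD
  | apply: measurable_funV | apply: measurable_funN
  | apply: measurable_ler_indic | apply: (measurableT_comp (@measurable_expR _))
  | apply: measurableT_comp ].

(** * One site between two fixed means *)

Section onedim.
Context {R : realType}.
Local Notation leb := (@lebesgue_measure R).
Local Notation pos := (`]0%R, +oo[%classic : set R).

Lemma measurable_pos : measurable (pos : set (measurableTypeR R)).
Proof. exact: measurable_itv. Qed.
Hint Resolve measurable_pos : core.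

(** The integrand is B times the exponential density of mean B, whose total mass is 1. *)
Lemma integral_expR_pos (B : R) : 0 < B ->
  leb.-integrable pos (EFin \o (fun a => expR (- a / B))) /\
  \int[leb]_(a in pos) expR (- a / B) = B.
Proof.
move=> B0.
have iB0 : 0 < B^-1 by rewrite invr_gt0.
have E : {in pos, (fun a => B%:E * (exponential_pdf B^-1 a)%:E)%E =1
                  EFin \o (fun a => expR (- a / B))}.
  move=> a; rewrite mem_setE in_itv/= andbT => a0.
  by rewrite exponential_pdfVE ltW//= -EFinM mulrA divff ?gt_eqF// mul1r.
have i1 : leb.-integrable pos (EFin \o exponential_pdf B^-1).
  apply: (@integrableS _ _ _ leb setT) => //.
  exact: integrable_exponential_pdf.
have i2 : leb.-integrable pos (EFin \o (fun a => expR (- a / B))).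
  have i0 : leb.-integrable pos (fun a => B%:E * (exponential_pdf B^-1 a)%:E)%E.
    exact: (integrableZl measurable_pos B i1).
  exact: (eq_integrable measurable_pos _ _ E i0).
split=> //.
rewrite /Rintegral [X in fine X](_ : _ =
    \int[leb]_(a in pos) (B%:E * (exponential_pdf B^-1 a)%:E))%E; last first.
  by apply: eq_integral => a /E /= ->.
rewrite integralZl//.
have -> : (\int[leb]_(a in pos) (exponential_pdf B^-1 a)%:E = 1)%E.
  rewrite -(integral_exponential_pdf iB0) integral_itv_obnd_cbnd; last first.
    by apply/measurable_EFinP; apply: measurable_funTS; exact: measurable_exponential_pdf.
  rewrite [LHS]integral_mkcond; apply: eq_integral => a _.
  rewrite patchE; case: ifPn => //; rewrite mem_setE in_itv/= andbT -ltNge => a0.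
  by rewrite lt0_exponential_pdf.
by rewrite mule1.
Qed.

(* [bond_rate z c m] is [W(z,c,m)]. Multiplying [frullani c m a] by
   [jump_factor z m a] puts the singular boundary terms of the generator and its
   jump integrals over [0, z] into a single absolutely convergent integral. *)
Definition jump_factor (z m a : R) : R := (a <= z)%R%:R * expR (a / m) - 1.
Definition frullani (c m a : R) : R := a^-1 * (expR (- a / c) - expR (- a / m)).
Definition bond_rate (z c m : R) : R :=
  \int[leb]_(a in pos) (jump_factor z m a * frullani c m a).

Lemma measurable_jump_factor d (T : measurableType d) z (m a : T -> R) :
  measurable_fun setT m -> measurable_fun setT a ->
  measurable_fun setT (fun t => jump_factor z (m t) (a t)).
Proof. by move=> mm ma; rewrite /jump_factor; measurability. Qed.

Lemma measurable_frullani d (T : measurableType d) (c m a : T -> R) :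
  measurable_fun setT c -> measurable_fun setT m -> measurable_fun setT a ->
  measurable_fun setT (fun t => frullani (c t) (m t) (a t)).
Proof. by move=> mc mm ma; rewrite /frullani; measurability. Qed.

Lemma measurable_bond_rate d (T : measurableType d) z (c m : T -> R) :
  measurable_fun setT c -> measurable_fun setT m ->
  measurable_fun setT (fun t => bond_rate z (c t) (m t)).
Proof.
move=> mc mm.
apply: (@measurable_Rintegral R _ _ T (measurableTypeR R) leb pos
  (fun p => jump_factor z (m p.1) p.2 * frullani (c p.1) (m p.1) p.2)) => //.
apply: measurable_funM.
  by apply: measurable_jump_factor; measurability.
by apply: measurable_frullani; measurability.
Qed.

Lemma jump_factor_bound (A z m a : R) : 0 < A -> A <= m -> 0 <= z -> 0 < a ->
  `|jump_factor z m a| <= expR (z / A).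
Proof.
move=> A0 Am z0 a0; rewrite /jump_factor.
have m0 : 0 < m by exact: lt_le_trans Am.
have e1 : 1 <= expR (z / A).
  by rewrite -(@expR0 R) ler_expR divr_ge0// ltW.
case: (boolP (a <= z)) => az; last by rewrite mul0r sub0r normrN normr1.
rewrite mul1r ger0_norm; last first.
  by rewrite subr_ge0 -[leLHS](@expR0 R) ler_expR divr_ge0// ltW.
rewrite lerBlDr ler_wpDr// ler_expR ler_pM//; [exact: ltW|by rewrite invr_ge0 ltW|].
by rewrite lef_pV2// posrE.
Qed.

(** For c <= m the difference of exponentials is e^{-a/m} (1 - e^{-y}) with y = a/c - a/m <= a/A.
    The inequality 1 - e^{-y} <= y therefore cancels the singular factor a^-1, leaving A^-1, and
    e^{-a/m} <= e^{-a/B} gives the decay. *)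
Lemma frullani_bound (A B c m a : R) : 0 < A -> A <= c <= B -> A <= m <= B -> 0 < a ->
  `|frullani c m a| <= A^-1 * expR (- a / B).
Proof.
move=> A0; wlog cm : c m / c <= m.
  move=> H cAB mAB a0; have [cm|/ltW mc] := leP c m; first exact: H.
  by rewrite -normrN /frullani -mulrN opprB; exact: H.
move=> /andP[Ac cB] /andP[Am mB] a0.
have c0 : 0 < c by exact: lt_le_trans Ac.
have m0 : 0 < m by exact: lt_le_trans Am.
have B0 : 0 < B by exact: lt_le_trans mB.
have le1 : a / m <= a / c by rewrite ler_pM2l// lef_pV2 ?posrE.
rewrite /frullani normrM gtr0_norm ?invr_gt0// ler0_norm; last first.
  by rewrite subr_le0 ler_expR !mulNr lerN2.
rewrite ler_pdivrMl// opprB.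
have -> : expR (- a / m) - expR (- a / c) =
    expR (- a / m) * (1 - expR (- (a / c - a / m))).
  by rewrite mulrBr mulr1 -expRD; congr (_ - expR _); field; rewrite !gt_eqF.
have h1 : expR (- a / m) <= expR (- a / B).
  by rewrite ler_expR !mulNr lerN2 ler_pM2l// lef_pV2 ?posrE.
have h2 : 1 - expR (- (a / c - a / m)) <= a / A.
  have := expR_ge1Dx (- (a / c - a / m)).
  have : a / c <= a / A by rewrite ler_pM2l// lef_pV2 ?posrE.
  have : 0 < a / m by rewrite divr_gt0.
  lra.
have h3 : 0 <= 1 - expR (- (a / c - a / m)).
  rewrite subr_ge0 -[leRHS](@expR0 R) ler_expR; lra.
rewrite mulrA mulrC; apply: ler_pM => //; exact: expR_ge0.
Qed.

Lemma bond_rate_integrand_bound (A B z c m a : R) :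
  0 < A -> A <= c <= B -> A <= m <= B -> 0 <= z -> 0 < a ->
  `|jump_factor z m a * frullani c m a| <= expR (z / A) / A * expR (- a / B).
Proof.
move=> A0 cAB mAB z0 a0; rewrite normrM -mulrA; apply: ler_pM => //.
  by apply: jump_factor_bound => //; have /andP[] := mAB.
exact: frullani_bound.
Qed.

Lemma integrable_scale_expR (C B : R) : 0 < B ->
  leb.-integrable pos (EFin \o (fun a => C * expR (- a / B))).
Proof. by move=> B0; apply: (integrableZl measurable_pos C (integral_expR_pos B0).1). Qed.

Lemma expR_dominated_integrable (C B : R) (f : R -> R) : 0 < B -> measurable_fun pos f ->
  (forall a, 0 < a -> `|f a| <= C * expR (- a / B)) ->
  leb.-integrable pos (EFin \o f) /\ `|\int[leb]_(a in pos) f a| <= C * B.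
Proof.
move=> B0 mf fC.
have i1 : leb.-integrable pos (EFin \o f).
  apply: (@dominated_integrable _ _ _ leb pos f _ measurable_pos mf (integrable_scale_expR C B0)).
  by move=> a; rewrite /= in_itv/= andbT; exact: fC.
split=> //; apply: (le_trans (le_normr_Rintegral measurable_pos i1)).
rewrite -[in leRHS](integral_expR_pos B0).2 -RintegralZl//; last exact: (integral_expR_pos B0).1.
apply: le_Rintegral => //.
- exact: (integrable_norm i1).
- exact: integrable_scale_expR.
- by move=> a; rewrite /= in_itv/= andbT; exact: fC.
Qed.

Lemma bond_rate_bound (A B z c m : R) : 0 < A -> A <= c <= B -> A <= m <= B -> 0 <= z ->
  leb.-integrable pos (EFin \o (fun a => jump_factor z m a * frullani c m a)) /\
  `|bond_rate z c m| <= expR (z / A) / A * B.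
Proof.
move=> A0 cAB mAB z0; apply: expR_dominated_integrable.
- by case/andP : cAB => Ac cB; exact: lt_le_trans (lt_le_trans A0 Ac) cB.
- apply: measurable_funTS; apply: measurable_funM.
    by apply: measurable_jump_factor; measurability.
  by apply: measurable_frullani; measurability.
- by move=> a a0; exact: bond_rate_integrand_bound.
Qed.

Lemma Rintegral_FTC2 (f F : R -> R) (a b : R) : a <= b ->
  (forall x, a <= x <= b -> {for x, continuous f}) ->
  (forall x, a <= x <= b -> is_derive x 1 F (f x)) ->
  \int[leb]_(x in `[a, b]) f x = F b - F a.
Proof. by move=> ab cf dF; rewrite /Rintegral (FTC2_closed ab cf dF). Qed.

(* [a * frullani_density a u] is the derivative of [expR (- a / u)] in [u]. *)
Definition frullani_density (a u : R) : R := u ^- 2 * expR (- a / u).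

Lemma measurable_frullani_density d (T : measurableType d) (a u : T -> R) :
  measurable_fun setT a -> measurable_fun setT u ->
  measurable_fun setT (fun t => frullani_density (a t) (u t)).
Proof.
move=> ma mu; rewrite /frullani_density; under eq_fun do rewrite expr2.
by measurability.
Qed.

Lemma is_derive_expR_div (a u : R) : 0 < u ->
  is_derive u 1 (fun u => expR (- a / u)) (a * frullani_density a u).
Proof.
move=> u0; have un0 : id u != 0 :> R by rewrite gt_eqF.
have dV := is_deriveV un0 (is_derive_id u 1).
apply: is_derive_eq.
by rewrite /frullani_density /GRing.scale /=; field.
Qed.

Lemma Rintegral_frullani_density (a c m : R) : 0 < a -> 0 < c -> c <= m ->
  \int[leb]_(u in `[c, m]) frullani_density a u = - frullani c m a.
Proof.
move=> a0 c0 cm.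
apply: (etrans (@Rintegral_FTC2 (frullani_density a) (fun u => a^-1 * expR (- a / u)) c m cm _ _)).
- move=> u /andP[cu _]; have u0 := lt_le_trans c0 cu.
  have un0 : id u != 0 :> R by rewrite gt_eqF.
  have dV := is_deriveV un0 (is_derive_id u 1).
  have u2n0 : (fun y : R => y ^+ 2) u != 0 by rewrite expf_neq0.
  have dV2 := @is_deriveV R (fun y => y ^+ 2) u _ 1 u2n0 (is_derive_pow 2 (is_derive_id u 1)).
  apply: differentiable_continuous; rewrite /frullani_density.
  by apply/derivable1_diffP; apply: ex_derive.
- move=> u /andP[cu _]; have u0 := lt_le_trans c0 cu.
  have := is_derive_expR_div a u0 => dE.
  apply: is_derive_eq.
  by rewrite /GRing.scale /= mulrA mulVf ?gt_eqF// mul1r.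
- by rewrite /= -mulrBr -mulrN opprB.
Qed.

(** * The antisymmetric integral over the square of temperatures *)

Section core.
Variables (a b z : R).
Hypotheses (a0 : 0 < a) (ab : a <= b) (z0 : 0 <= z).

Let b0 : 0 < b. Proof. exact: lt_le_trans ab. Qed.

(** The sign of u - m, zero on the diagonal. As a difference of two indicators it splits an integral
    over [a, b] into one over [m, b] and one over [a, m]. *)
Let s (u m : R) : R := (m <= u)%R%:R - (u <= m)%R%:R.

Let mab : measurable (`[a, b]%classic : set (measurableTypeR R)).
Proof. exact: measurable_itv. Qed.

Let aboo : (leb `[a, b]%classic < +oo)%E.
Proof. by rewrite /= lebesgue_measure_itv /=; case: ifP => _; rewrite ?ltry. Qed.

Let s_le1 u m : `|s u m| <= 1.
Proof.
by rewrite /s; case: (ltgtP m u) => _ /=;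
  rewrite ?subrr ?subr0 ?sub0r ?normrN ?normr1 ?normr0.
Qed.

Let frullani_density_bound c u : a <= u <= b -> 0 < c ->
  `|frullani_density c u| <= a ^- 2 * expR (- c / b).
Proof.
move=> /andP[au ub] c0; have u0 : 0 < u by exact: lt_le_trans au.
rewrite /frullani_density ger0_norm; last first.
  by rewrite mulr_ge0 ?expR_ge0// invr_ge0 exprn_ge0// ltW.
apply: ler_pM.
- by rewrite invr_ge0 exprn_ge0// ltW.
- exact: expR_ge0.
- by rewrite lef_pV2 ?posrE ?exprn_gt0// lerXn2r// nnegrE ltW.
- by rewrite ler_expR !mulNr lerN2 ler_pM2l// lef_pV2 ?posrE.
Qed.

Let measurable_s d (T : measurableType d) (u m : T -> R) :
  measurable_fun setT u -> measurable_fun setT m ->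
  measurable_fun setT (fun t => s (u t) (m t)).
Proof. by move=> mu mm; rewrite /s; measurability. Qed.

(** Here [a] and [b] are the means of the two neighbours and [c] is the jump size. The neighbour
    means lie on opposite sides of m, so the two differences of exponentials are integrals of the
    same density with opposite orientation; this is the origin of the sign. *)
Let frullani_pair m c : a <= m <= b -> 0 < c ->
  frullani a m c + frullani b m c = \int[leb]_(u in `[a, b]) (s u m * frullani_density c u).
Proof.
move=> /andP[am mb] c0; have m0 : 0 < m by exact: lt_le_trans am.
have mh : measurable_fun (`[a, b]%classic : set (measurableTypeR R)) (frullani_density c).
  apply: measurable_funTS.
  exact: (@measurable_frullani_density _ (measurableTypeR R) (cst c) id).
have hint (f : R -> R) : measurable_fun [set: measurableTypeR R] f -> (forall u, `|f u| <= 1) ->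
    leb.-integrable `[a, b] (EFin \o (fun u => f u * frullani_density c u)).
  move=> mf f1; apply: (@bounded_integrable _ _ _ leb _ _ (a ^- 2 * expR (- c / b))) => //.
    by apply: measurable_funM => //; exact: measurable_funTS.
  move=> u; rewrite /= in_itv/= => uab; rewrite normrM -[leRHS]mul1r.
  by apply: ler_pM => //; exact: frullani_density_bound.
under [RHS]eq_Rintegral do rewrite /s mulrBl.
rewrite RintegralB//; last 2 first.
- apply: (hint (fun u => (m <= u)%R%:R)); first by measurability.
  by move=> u; case: (m <= u); rewrite ?normr0 ?normr1.
- apply: (hint (fun u => (u <= m)%R%:R)); first by measurability.
  by move=> u; case: (u <= m); rewrite ?normr0 ?normr1.
have -> : \int[leb]_(u in `[a, b]) ((m <= u)%R%:R * frullani_density c u) = frullani b m c.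
  transitivity (\int[leb]_(u in `[m, b]) frullani_density c u); last first.
    by rewrite Rintegral_frullani_density// /frullani -mulrN opprB.
  rewrite Rintegral_mkcond [RHS]Rintegral_mkcond; congr Rintegral; apply/funext => u.
  rewrite !patchE !mem_setE !in_itv/=; case: (leP m u) => mu /=.
    by rewrite (le_trans am mu) mul1r.
  by rewrite mul0r if_same.
have -> : \int[leb]_(u in `[a, b]) ((u <= m)%R%:R * frullani_density c u) = - frullani a m c.
  transitivity (\int[leb]_(u in `[a, m]) frullani_density c u); last first.
    by rewrite Rintegral_frullani_density.
  rewrite Rintegral_mkcond [RHS]Rintegral_mkcond; congr Rintegral; apply/funext => u.
  rewrite !patchE !mem_setE !in_itv/=; case: (leP u m) => mu /=.
    by rewrite (le_trans mu mb) andbT mul1r.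
  by rewrite andbF mul0r if_same.
by rewrite opprK addrC.
Qed.

Let H u m : R := \int[leb]_(c in pos) (jump_factor z m c * frullani_density c u).

Let factor_density_bound m u c : a <= m -> a <= u <= b -> 0 < c ->
  `|jump_factor z m c * frullani_density c u| <= expR (z / a) * a ^- 2 * expR (- c / b).
Proof.
move=> am uab c0; rewrite normrM -mulrA; apply: ler_pM => //; last exact: frullani_density_bound.
exact: jump_factor_bound.
Qed.

Let H_bound u m : a <= u <= b -> a <= m -> `|H u m| <= expR (z / a) * a ^- 2 * b.
Proof.
move=> uab am; apply: (expR_dominated_integrable _ _ _).2 => //.
  apply: measurable_funTS; apply: measurable_funM.
    by apply: measurable_jump_factor; measurability.
  by apply: measurable_frullani_density; measurability.
by move=> c c0; exact: factor_density_bound.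
Qed.

Let bond_rate_pair m : a <= m <= b ->
  bond_rate z a m + bond_rate z b m = \int[leb]_(u in `[a, b]) (s u m * H u m).
Proof.
move=> mab'; have /andP[am mb] := mab'.
rewrite /bond_rate -RintegralD//; last 2 first.
- by apply: (bond_rate_bound a0 (B := b) _ _ z0).1 => //; rewrite lexx ab.
- by apply: (bond_rate_bound a0 (B := b) _ _ z0).1 => //; rewrite lexx ab.
transitivity (\int[leb]_(c in pos) \int[leb]_(u in `[a, b])
    (jump_factor z m c * (s u m * frullani_density c u))).
  apply: eq_Rintegral => c; rewrite mem_setE in_itv/= andbT => c0.
  rewrite -mulrDr frullani_pair// RintegralZl//.
  apply: (@bounded_integrable _ _ _ leb _ _ (a ^- 2 * expR (- c / b))) => //.
    apply: measurable_funTS; apply: measurable_funM.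
      by apply: measurable_s; measurability.
    by apply: measurable_frullani_density; measurability.
  move=> u; rewrite /= in_itv/= => uab; rewrite normrM -[leRHS]mul1r.
  by apply: ler_pM => //; exact: frullani_density_bound.
(* The jump size comes first because it is the unbounded variable: the bound by e^{-c/b} holds for
   every u in [a, b], an interval of finite length. *)
rewrite (@Rfubini _ _ _ (measurableTypeR R) (measurableTypeR R) leb leb pos _
  (fun c u => jump_factor z m c * (s u m * frullani_density c u))
  (fun c => expR (z / a) * a ^- 2 * expR (- c / b)))//.
- apply: eq_Rintegral => u; rewrite mem_setE in_itv/= => uab.
  under eq_Rintegral do rewrite mulrCA.
  rewrite RintegralZl//; apply: (expR_dominated_integrable b0 _ _).1.
    apply: measurable_funTS; apply: measurable_funM.
      by apply: measurable_jump_factor; measurability.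
    by apply: measurable_frullani_density; measurability.
  by move=> c c0; exact: factor_density_bound.
- apply: measurable_funM; first by apply: measurable_jump_factor; measurability.
  by apply: measurable_funM; [apply: measurable_s|apply: measurable_frullani_density]; measurability.
- exact: integrable_scale_expR.
- move=> c u; rewrite /= !in_itv/= andbT => c0 uab.
  rewrite mulrCA normrM -[leRHS]mul1r; apply: ler_pM => //.
  exact: factor_density_bound.
Qed.

Let E (u : R) := u^-1 * expR (- z / u).

(** With g = 1/m - 1/u, the factors e^{c/m} and e^{-c/u} combine into e^{c g}, whose integral up to
    z gives (e^{z g} - 1) / (u^2 g); the -1 in [jump_factor] gives -1/u. Multiplying by [E m] turns
    e^{z g} into e^{-z/u}, and g u m = u - m collects everything into the divided difference of
    [E]. *)
Let H_closed_form u m : 0 < u -> 0 < m -> u != m -> E m * H u m = (E u - E m) / (u - m).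
Proof.
move=> u0 m0 um.
have un0 : u != 0 by rewrite gt_eqF.
have mn0 : m != 0 by rewrite gt_eqF.
pose g := m^-1 - u^-1.
have gn0 : g != 0 by rewrite subr_eq0 (inj_eq invr_inj) eq_sym.
pose f (c : R) : R := u ^- 2 * expR (c * g).
have fE c : expR (c / m) * frullani_density c u = f c.
  by rewrite mulrCA -expRD /f; congr (_ * expR _); rewrite /g; ring.
(* For u > m the exponent g is positive and [f] grows. The cut-off at z gives e^{c/m} <= e^{z/m},
   and the decay comes from e^{-c/u}. *)
have i1 : leb.-integrable pos (EFin \o (fun c => (c <= z)%R%:R * f c)).
  apply: (expR_dominated_integrable (C := expR (z / m) * u ^- 2) u0 _ _).1.
    apply: measurable_funTS; rewrite /f; apply: measurable_funM; first by measurability.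
    by measurability.
  move=> c c0; case: (boolP (c <= z)) => cz; last first.
    by rewrite mul0r normr0 mulr_ge0 ?expR_ge0// mulr_ge0 ?expR_ge0// invr_ge0 exprn_ge0// ltW.
  rewrite mul1r -fE /frullani_density -mulrA ger0_norm; last first.
    by rewrite mulr_ge0 ?expR_ge0// mulr_ge0 ?expR_ge0// invr_ge0 exprn_ge0// ltW.
  rewrite ler_wpM2r//.
    by rewrite mulr_ge0 ?expR_ge0// invr_ge0 exprn_ge0// ltW.
  by rewrite ler_expR ler_wpM2r// invr_ge0 ltW.
have i2 : leb.-integrable pos (EFin \o frullani_density^~ u).
  exact: (integrable_scale_expR (u ^- 2) u0).
have -> : H u m = (u ^- 2 / g) * (expR (z * g) - 1) - u^-1.
  transitivity (\int[leb]_(c in pos) ((c <= z)%R%:R * f c - frullani_density c u)).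
    apply: eq_Rintegral => c _; rewrite /jump_factor mulrBl mul1r -mulrA fE//.
  rewrite RintegralB//; congr (_ - _); last first.
    rewrite RintegralZl//; last exact: (integral_expR_pos u0).1.
    by rewrite (integral_expR_pos u0).2; field.
  transitivity (\int[leb]_(c in `]0%R, z]) f c).
    rewrite Rintegral_mkcond [RHS]Rintegral_mkcond; congr Rintegral; apply/funext => c.
    rewrite !patchE !mem_setE !in_itv/= andbT; case: (leP c z) => cz /=.
      by rewrite andbT mul1r.
    by rewrite andbF mul0r if_same.
  have cf (c : R) : {for c, continuous f}.
    apply: differentiable_continuous.
    by apply/derivable1_diffP; apply: ex_derive.
  rewrite Rintegral_itv_obnd_cbnd; last first.
    apply: (@integrableS _ _ _ leb `[0, z]%classic) => //.
      by apply: subset_itvr; rewrite bnd_simp.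
    apply: continuous_compact_integrable; first exact: segment_compact.
    by apply: continuous_in_subspaceT => c _; exact: cf.
  apply: (etrans (@Rintegral_FTC2 f (fun c => u ^- 2 / g * expR (c * g)) 0 z z0 _ _)) => //.
    move=> c _; apply: is_derive_eq.
    rewrite scaler0 add0r /GRing.scale /= /f; field.
    by rewrite un0 gn0.
  by rewrite mul0r expR0; ring.
have eE : expR (- z / m) * expR (z * g) = expR (- z / u).
  by rewrite -expRD; congr expR; rewrite /g; ring.
rewrite /E -eE.
have -> : u - m = g * (u * m) by rewrite /g; field; rewrite un0.
rewrite /g; field.
by rewrite un0 mn0 /= mulN1r subr_eq0.
Qed.

Lemma Rintegral_bond_rate_pair :
  \int[leb]_(m in `[a, b]) (m^-1 * expR (- z / m) * (bond_rate z a m + bond_rate z b m)) = 0.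
Proof.
pose G u m := s u m * ((E u - E m) / (u - m)).
(* On the diagonal both sides vanish through [s], so the case u = m excluded from the closed form is
   harmless. *)
have GH u m : a <= u -> a <= m -> E m * (s u m * H u m) = G u m.
  move=> au am; rewrite mulrCA /G; have [->|um] := eqVneq u m.
    by rewrite /s subrr !mul0r.
  by rewrite H_closed_form//; exact: lt_le_trans a0 _.
have Gsym u m : G m u = - G u m.
  rewrite /G /s; have [->|um] := eqVneq u m; first by rewrite !subrr !mul0r oppr0.
  have -> : (E m - E u) / (m - u) = (E u - E m) / (u - m).
    by rewrite -(opprB u m) invrN -(opprB (E u) (E m)) mulrNN.
  by ring.
transitivity (\int[leb]_(m in `[a, b]) \int[leb]_(u in `[a, b]) G u m).
  apply: eq_Rintegral => m; rewrite mem_setE in_itv/= => mm.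
  rewrite bond_rate_pair// -RintegralZl//.
    apply: eq_Rintegral => u; rewrite mem_setE in_itv/= => /andP[au _].
    by rewrite -/(E m) GH//; have /andP[] := mm.
  apply: (@bounded_integrable _ _ _ leb _ _ (expR (z / a) * a ^- 2 * b)) => //.
    apply: measurable_funTS; apply: measurable_funM; first by apply: measurable_s; measurability.
    apply: (@measurable_Rintegral R _ _ (measurableTypeR R) (measurableTypeR R) leb pos
      (fun p => jump_factor z m p.2 * frullani_density p.2 p.1)) => //.
    by apply: measurable_funM; [apply: measurable_jump_factor|apply: measurable_frullani_density]; measurability.
  move=> u; rewrite /= in_itv/= => uab; rewrite normrM -[leRHS]mul1r.
  by apply: ler_pM => //; apply: H_bound => //; have /andP[] := mm.
set I := (X in X = 0).
suff : I = - I by lra.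
have mG : measurable_fun setT (fun p : measurableTypeR R * measurableTypeR R => G p.2 p.1).
  apply: measurable_funM; first by apply: measurable_s; measurability.
  by rewrite /E; measurability.
(* The difference quotient is not estimated near the diagonal directly: [GH] turns it back into
   [E m] times [H], where [E m] is at most 1/a and [H_bound] is uniform. *)
have G_bound u m : a <= u <= b -> a <= m <= b ->
    `|G u m| <= a^-1 * (expR (z / a) * a ^- 2 * b).
  move=> /[dup] uab /andP[au _] /andP[am mb]; rewrite -GH// normrM.
  have m0 : 0 < m by exact: lt_le_trans am.
  apply: ler_pM => //.
    rewrite /E ger0_norm; last by rewrite mulr_ge0 ?expR_ge0// invr_ge0 ltW.
    rewrite -[leRHS]mulr1; apply: ler_pM; rewrite ?expR_ge0 ?invr_ge0 ?(ltW m0)//.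
      by rewrite lef_pV2 ?posrE.
    by rewrite -[leRHS](@expR0 R) ler_expR mulNr oppr_le0 divr_ge0// ltW.
  by rewrite normrM -[leRHS]mul1r; apply: ler_pM => //; exact: H_bound.
have iC : leb.-integrable `[a, b] (EFin \o cst (a^-1 * (expR (z / a) * a ^- 2 * b))).
  exact: (@bounded_integrable _ _ _ leb _ _ `|a^-1 * (expR (z / a) * a ^- 2 * b)|).
have Gb' (m u : measurableTypeR R) : `[a, b]%classic m -> `[a, b]%classic u ->
    `|G u m| <= cst (a^-1 * (expR (z / a) * a ^- 2 * b)) m.
  by rewrite /= !in_itv/= => ? ?; exact: G_bound.
rewrite {1}/I (@Rfubini _ _ _ (measurableTypeR R) (measurableTypeR R) leb leb _ _
  (fun m u => G u m) _ mab mab aboo mG iC Gb').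
(* After the exchange the two variables are renamed, so that the inner integrand is G m u, which
   [Gsym] turns into - G u m. *)
transitivity (\int[leb]_(m in `[a, b]) (-1 * \int[leb]_(u in `[a, b]) G u m)).
  apply: eq_Rintegral => m; rewrite mem_setE in_itv/= => mm.
  rewrite -RintegralZl//; last first.
    exact: (integrable_section1 mab aboo mG Gb' (x := m)).
  by apply: eq_Rintegral => u _; rewrite mulN1r.
rewrite RintegralZl ?mulN1r//.
exact: (integrable_Rintegral2 mab mab aboo mG iC Gb').
Qed.

End core.
End onedim.

(** * The mixture density *)

Section mixture.
Context {R : realType}.
Local Notation leb := (@lebesgue_measure R).

Lemma measurable_exponential_product d (T : measurableType d) n (m z : T -> vec R n) :
  measurable_fun setT m -> measurable_fun setT z ->
  measurable_fun setT (fun t => exponential_product (m t) (z t)).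
Proof.
move=> mm mz; rewrite /exponential_product; apply: measurable_prod => x _.
have mmx : measurable_fun setT (fun t => tnth (m t) x : R).
  by apply: (measurableT_comp (measurable_tnth x)).
have mzx : measurable_fun setT (fun t => tnth (z t) x : R).
  by apply: (measurableT_comp (measurable_tnth x)).
rewrite (_ : (fun _ => _) = (fun t => (0 <= (tnth (z t) x : R))%R%:R *
   ((tnth (m t) x : R)^-1 * expR (- (tnth (z t) x : R) / (tnth (m t) x : R))))).
  by measurability.
apply/funext => t; rewrite exponential_pdfVE.
by case: ifP => _; rewrite ?mul1r ?mul0r.
Qed.

Lemma exponential_product_vcons n (x z0 : R) (t z : vec R n) :
  exponential_product (vcons (x, t)) (vcons (z0, z)) =
  exponential_pdf x^-1 z0 * exponential_product t z.
Proof.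
rewrite /exponential_product big_ord_recl; congr (_ * _).
by apply: eq_bigr => i _; rewrite !tnthS.
Qed.

Lemma exponential_product_ge0 n (m z : vec R n) :
  (forall x, 0 < (tnth m x : R)) -> 0 <= exponential_product m z.
Proof.
move=> m0; apply: prodr_ge0 => x _.
by apply: exponential_pdf_ge0; rewrite invr_ge0 ltW.
Qed.

Lemma exponential_pdf_le (A m z : R) : 0 < A -> A <= m -> exponential_pdf m^-1 z <= A^-1.
Proof.
move=> A0 Am; have m0 : 0 < m by exact: lt_le_trans Am.
rewrite exponential_pdfVE; case: ifPn => z0; last by rewrite invr_ge0 ltW.
rewrite -[leRHS]mulr1; apply: ler_pM; rewrite ?expR_ge0 ?invr_ge0 ?(ltW m0)//.
  by rewrite lef_pV2 ?posrE.
by rewrite -[leRHS](@expR0 R) ler_expR mulNr oppr_le0 divr_ge0// ltW.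
Qed.

Lemma ordered_means_gt0 n (a b : R) (m : vec R n) :
  0 < a -> ordered_means n a b m -> forall x, 0 < (tnth m x : R).
Proof. by move=> a0 [h _] x; have /andP[+ _] := h x; exact: lt_le_trans. Qed.

Lemma exponential_product_bound n (a b : R) (m z : vec R n) :
  0 < a -> ordered_means n a b m -> `|exponential_product m z| <= a^-1 ^+ n.
Proof.
move=> a0 om; rewrite ger0_norm; last exact/exponential_product_ge0/(ordered_means_gt0 a0 om).
rewrite (_ : a^-1 ^+ n = \prod_(i < n) a^-1); last by rewrite prodr_const card_ord.
apply: ler_prod => x _; apply/andP; split.
  by apply: exponential_pdf_ge0; rewrite invr_ge0 ltW// (ordered_means_gt0 a0 om).
by apply: exponential_pdf_le => //; have [/(_ x)/andP[]] := om.
Qed.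

Lemma nth_ordered_means n (a b : R) (m : vec R n) i : a <= b -> ordered_means n a b m ->
  a <= nth b m i <= b.
Proof.
move=> ab [h _]; have [ni|ni] := leqP n i.
  by rewrite nth_default ?size_tuple// ab lexx.
by have := h (Ordinal ni); rewrite (tnth_nth b).
Qed.

Lemma nth_cons_ordered_means n (a b : R) (m : vec R n) i : a <= b -> ordered_means n a b m ->
  a <= nth b (a :: m) i <= b.
Proof. by move=> ab om; case: i => [|i] /=; [rewrite lexx ab|exact: nth_ordered_means]. Qed.

Lemma measurable_nth_cons n (a b : R) i :
  measurable_fun [set: vec R n] (fun t : vec R n => nth b (a :: t) i).
Proof. by case: i => [|i] /=; [exact: measurable_cst|exact: measurable_nth]. Qed.

(* The two bonds of the site [i]: its left neighbour is [nth b (a :: m) i] and its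
   right neighbour [nth b m i.+1], so that [a] and the default value [b] act as the
   means of the two reservoirs. *)
Definition site_term n (a b : R) (z : vec R n) (i : 'I_n) (m : vec R n) : R :=
  exponential_product m z * (bond_rate (tnth z i) (nth b (a :: m) i) (tnth m i) +
                             bond_rate (tnth z i) (nth b m i.+1) (tnth m i)).

Lemma measurable_site_term n (a b : R) (z : vec R n) i :
  measurable_fun setT (site_term a b z i).
Proof.
apply: measurable_funM.
  by apply: measurable_exponential_product; [exact: measurable_id|exact: measurable_cst].
apply: measurable_funD; apply: measurable_bond_rate.
- exact: measurable_nth_cons.
- exact: measurable_tnth.
- exact: measurable_nth.
- exact: measurable_tnth.
Qed.

Lemma site_term_bound n (a b : R) (z : vec R n) i m : 0 < a -> a <= b ->
  0 <= (tnth z i : R) -> ordered_means n a b m ->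
  `|site_term a b z i m| <= a^-1 ^+ n * (expR ((tnth z i : R) / a) / a * b +
                                         expR ((tnth z i : R) / a) / a * b).
Proof.
move=> a0 ab z0 om; rewrite normrM; apply: ler_pM => //.
  exact: exponential_product_bound om.
have mi : a <= tnth m i <= b by have [h _] := om; exact: h.
apply: (le_trans (ler_normD _ _)); apply: lerD.
  exact: (bond_rate_bound a0 (nth_cons_ordered_means i ab om) mi z0).2.
exact: (bond_rate_bound a0 (nth_ordered_means i.+1 ab om) mi z0).2.
Qed.

(** Once the first mean x is fixed, it acts as the left reservoir of the remaining sites: [a] is
    replaced by [x]. *)
Lemma site_term_lift n (a b x z1 : R) (z t : vec R n) (j : 'I_n) :
  site_term a b (vcons (z1, z)) (lift ord0 j) (vcons (x, t)) =
  exponential_pdf x^-1 z1 * site_term x b z j t.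
Proof.
rewrite /site_term exponential_product_vcons -mulrA.
have -> : tnth (vcons (x, t)) (lift ord0 j) = tnth t j by exact: tnthS.
have -> : tnth (vcons (z1, z)) (lift ord0 j) = tnth z j by exact: tnthS.
by [].
Qed.

(** The mean of the first site enters only its own exponential factor and its two bonds, so the rest
    is a constant for the inner integral. With one site, [head b t] is the right reservoir [b]. *)
Lemma site_term0 n (a b x z1 : R) (z t : vec R n) : 0 <= z1 ->
  site_term a b (vcons (z1, z)) ord0 (vcons (x, t)) =
  exponential_product t z *
    (x^-1 * expR (- z1 / x) * (bond_rate z1 a x + bond_rate z1 (head b t) x)).
Proof.
move=> z10; rewrite /site_term exponential_product_vcons exponential_pdfVE z10.
have -> : nth b (vcons (x, t)) (@ord0 n).+1 = head b t by exact: nth0.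
by rewrite mulrAC mulrC.
Qed.

(** Induction on the number of sites with the left temperature [a] general: for a later site the
    first mean is frozen and becomes the left temperature of a shorter chain. Only a first site
    calls for [Rintegral_bond_rate_pair]. *)
Lemma Rintegral_site_term n (a b : R) (z : vec R n) i : 0 < a -> a <= b ->
  (forall x, 0 <= (tnth z x : R)) ->
  \int[lebesgue_tuple n]_(m in ordered_means n a b) site_term a b z i m = 0.
Proof.
elim: n a z i => [|n IHn] a z i a0 ab z0; first by case: i.
have mF := @measurable_site_term n.+1 a b z i.
have FC m := @site_term_bound n.+1 a b z i m a0 ab (z0 i).
(* For the first site, the order of integration is exchanged so that its mean is
   integrated innermost, between [a] and the mean of the next site. *)
case: (unliftP ord0 i) => [j|] ij.
  rewrite (Rintegral_ordered_means12 mF FC).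
  (* Zero is written as the integral of the constant 0, so it suffices that the inner integral
     vanishes for each x. *)
  rewrite -[RHS](mul0r (fine (leb `[a, b]%classic))) -(Rintegral_cst leb);
    last exact: measurable_itv.
  apply: eq_Rintegral => x; rewrite mem_setE in_itv/= => /andP[ax xb].
  case/tupleP: z z0 {mF FC} => z1 z z0; rewrite ij.
  have x0 := lt_le_trans a0 ax.
  have z0' k : 0 <= (tnth z k : R) by have := z0 (lift ord0 k); rewrite tnthS.
  transitivity (\int[lebesgue_tuple n]_(t in ordered_means n x b)
      (exponential_pdf x^-1 z1 * site_term x b z j t)).
    apply: eq_Rintegral => t _; exact: site_term_lift.
  rewrite RintegralZl ?IHn ?mulr0//; first exact: measurable_ordered_means.
  apply: (bounded_integrable (measurable_ordered_means _ _) (ordered_means_fin _ _ _)).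
    by apply: measurable_funTS; exact: measurable_site_term.
  by move=> t ot; exact: site_term_bound.
rewrite (Rintegral_ordered_means21 mF FC).
rewrite -[RHS](mul0r (fine (lebesgue_tuple n (ordered_means n a b)))).
rewrite -(Rintegral_cst (lebesgue_tuple n)); last exact: measurable_ordered_means.
apply: eq_Rintegral => t /set_mem ot.
case/tupleP: z z0 {mF FC} => z1 z z0; rewrite ij.
have z10 : 0 <= z1 by exact: (z0 ord0).
have /andP[ah hb] : a <= head b t <= b by rewrite -nth0; exact: nth_ordered_means.
transitivity (\int[leb]_(x in `[a, head b t]) (exponential_product t z *
    (x^-1 * expR (- z1 / x) * (bond_rate z1 a x + bond_rate z1 (head b t) x)))).
  by apply: eq_Rintegral => x _; rewrite site_term0.
have mh : measurable (`[a, head b t]%classic : set (measurableTypeR R)) by exact: measurable_itv.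
rewrite RintegralZl ?Rintegral_bond_rate_pair ?mulr0//.
apply: (@bounded_integrable _ _ _ leb _ _ (a^-1 * (expR (z1 / a) / a * head b t +
   expR (z1 / a) / a * head b t))) => //.
- by rewrite /= lebesgue_measure_itv /=; case: ifP => _; rewrite ?ltry.
- apply: measurable_funTS; apply: measurable_funM; first by measurability.
  by apply: measurable_funD; apply: measurable_bond_rate; measurability.
- move=> x; rewrite /= in_itv/= => axh; have /andP[ax xh] := axh.
  have x0 := lt_le_trans a0 ax.
  rewrite normrM; apply: ler_pM => //.
    have := @exponential_pdf_le a x z1 a0 ax; rewrite exponential_pdfVE z10.
    by rewrite ger0_norm// mulr_ge0 ?expR_ge0// invr_ge0 ltW.
  apply: (le_trans (ler_normD _ _)); apply: lerD;
    by apply: (bond_rate_bound a0 _ axh z10).2; rewrite lexx ah.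
Qed.

Lemma integral_exponential_product n (m : vec R n) :
  (forall x, 0 < (tnth m x : R)) ->
  (\int[lebesgue_tuple n]_z (exponential_product m z)%:E = 1)%E.
Proof.
elim: n m => [|n IHn] m m0.
  under eq_integral do rewrite /exponential_product big_ord0.
  by rewrite integral_cst// mul1e /= /dirac indicT.
case/tupleP: m m0 => x m m0.
have x0 : 0 < x by exact: (m0 ord0).
have m0' k : 0 < (tnth m k : R) by have := m0 (lift ord0 k); rewrite tnthS.
rewrite ge0_integral_tupleS; last 2 first.
- apply/measurable_EFinP.
  by apply: measurable_exponential_product; [exact: measurable_cst|exact: measurable_id].
- by move=> t; rewrite lee_fin exponential_product_ge0.
transitivity (\int[leb]_z0 (exponential_pdf x^-1 z0)%:E)%E; last first.
  by apply: integral_exponential_pdf; rewrite invr_gt0.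
apply: eq_integral => z0 _.
have p0 : 0 <= exponential_pdf x^-1 z0 by apply: exponential_pdf_ge0; rewrite invr_ge0 ltW.
transitivity (\int[lebesgue_tuple n]_t
    ((exponential_pdf x^-1 z0)%:E * (exponential_product m t)%:E))%E.
  apply: eq_integral => t _.
  by rewrite -[in exponential_product _ _]/(vcons (x, m)) exponential_product_vcons EFinM.
rewrite ge0_integralZl//.
- by rewrite IHn// mule1.
- apply/measurable_EFinP.
  by apply: measurable_exponential_product; [exact: measurable_cst|exact: measurable_id].
- by move=> t _; rewrite lee_fin exponential_product_ge0.
Qed.

Lemma integrable_exponential_product n (a b : R) (z : vec R n) : 0 < a ->
  (lebesgue_tuple n).-integrable (ordered_means n a b)
    (EFin \o (fun m => exponential_product m z)).
Proof.
move=> a0.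
apply: (bounded_integrable (measurable_ordered_means _ _) (ordered_means_fin _ _ _)).
  apply: measurable_funTS.
  by apply: measurable_exponential_product; [exact: measurable_id|exact: measurable_cst].
by move=> t ot; exact: exponential_product_bound ot.
Qed.

Lemma mixture_is_density n (a b : R) : 0 < a -> a < b ->
  is_density (mixture_density n a b).
Proof.
move=> a0 ab; have vol := lebesgue_ordered_means n (ltW ab).
have V0 : 0 < (b - a) ^+ n / n`!%:R :> R.
  by rewrite divr_gt0// ?exprn_gt0 ?subr_gt0// ltr0n fact_gt0.
rewrite /mixture_density vol /=; set V := _ / _.
split.
- apply: measurable_funM => //.
  apply: (@measurable_Rintegral R _ _ _ _ (lebesgue_tuple n) (ordered_means n a b)
    (fun p => exponential_product p.2 p.1)) => //; first exact: measurable_ordered_means.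
  by apply: measurable_exponential_product; measurability.
- move=> z; rewrite mulr_ge0 ?invr_ge0 ?(ltW V0)//; apply: Rintegral_ge0 => m om.
  exact/exponential_product_ge0/(ordered_means_gt0 a0 om).
- move=> z [x zx]; rewrite [X in _ * X](_ : _ = 0) ?mulr0//.
  rewrite -[RHS](mul0r (fine (lebesgue_tuple n (ordered_means n a b)))).
  rewrite -(Rintegral_cst (lebesgue_tuple n)); last exact: measurable_ordered_means.
  apply: eq_Rintegral => m _; apply/eqP; rewrite prodf_seq_eq0; apply/hasP.
  by exists x; rewrite ?mem_index_enum//= lt0_exponential_pdf.
(* For the total mass, Tonelli exchanges z and m; each product of exponential densities has mass 1,
   and the volume [V] remains to cancel [V^-1]. *)
pose f (p : vec R n * vec R n) : \bar R :=
  (exponential_product p.2 p.1 * \1_(ordered_means n a b) p.2)%:E.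
have f0 p : (0 <= f p)%E.
  rewrite lee_fin indicE; case: (boolP (_ \in _)) => [/set_mem om|_]; last by rewrite mulr0.
  by rewrite mulr1; exact/exponential_product_ge0/(ordered_means_gt0 a0 om).
have mf : measurable_fun setT f.
  apply/measurable_EFinP; apply: measurable_funM.
    by apply: measurable_exponential_product; measurability.
  apply: measurableT_comp => //.
  exact: (measurable_indic (measurable_ordered_means a b)).
transitivity (\int[lebesgue_tuple n]_z (V^-1%:E * \int[lebesgue_tuple n]_m f (z, m)))%E.
  apply: eq_integral => z _; rewrite EFinM; congr (_ * _)%E.
  rewrite /Rintegral fineK; last first.
    apply: integrable_fin_num (integrable_exponential_product _ _ a0).
    exact: measurable_ordered_means.
  rewrite integral_mkcond; apply: eq_integral => m _.
  by rewrite patchE /f indicE; case: ifP => _; rewrite ?mulr1 ?mulr0.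
rewrite ge0_integralZl//; last 3 first.
- exact: measurable_fun_fubini_tonelli_F.
- by move=> z _; apply: integral_ge0 => m _.
- by rewrite lee_fin invr_ge0 ltW.
rewrite fubini_tonelli//.
rewrite (_ : \int[_]_y _ = V%:E)%E; first by rewrite -EFinM mulVf// gt_eqF.
rewrite -vol -[RHS]mul1e -integral_cst; last exact: measurable_ordered_means.
rewrite [RHS]integral_mkcond; apply: eq_integral => m _.
rewrite patchE; case: ifPn => om.
  under eq_integral do rewrite /f indicE /= om mulr1.
  exact/integral_exponential_product/(ordered_means_gt0 a0 (set_mem om)).
under eq_integral do rewrite /f indicE /= (negbTE om) mulr0.
by rewrite integral0.
Qed.

End mixture.

(** * Changing the energy of one site *)

Section shift.
Context {R : realType}.

Lemma tnth_add_at n (z : vec R n) x s y :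
  tnth (add_at z x s) y = (tnth z y : R) + s *+ (y == x).
Proof. by rewrite /add_at tnth_mktuple. Qed.

Lemma measurable_add_at d (T : measurableType d) n (z : T -> vec R n) x (s : T -> R) :
  measurable_fun setT z -> measurable_fun setT s ->
  measurable_fun setT (fun t => add_at (z t) x (s t)).
Proof.
move=> mz ms; apply/measurable_fun_tnthP => y.
rewrite (_ : _ \o _ = (fun t => (tnth (z t) y : R) + s t *+ (y == x))); last first.
  by apply/funext => t /=; rewrite tnth_add_at.
apply: measurable_funD; first by apply: (measurableT_comp (measurable_tnth y)).
by case: (y == x) => //=; exact: measurable_cst.
Qed.

Lemma exponential_product_add_at n (m z : vec R n) x s :
  0 <= (tnth z x : R) -> 0 <= (tnth z x : R) + s ->
  exponential_product m (add_at z x s) =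
  exponential_product m z * expR (- s / (tnth m x : R)).
Proof.
move=> z0 zs; rewrite /exponential_product (bigD1 x)//= [in RHS](bigD1 x)//=.
rewrite tnth_add_at eqxx mulr1n [RHS]mulrAC; congr (_ * _).
  by rewrite !exponential_pdfVE z0 zs -mulrA -expRD opprD mulrDl.
by apply: eq_bigr => y yx; rewrite tnth_add_at (negbTE yx) mulr0n addr0.
Qed.

Lemma exponential_product_add_at0 n (m z : vec R n) x s :
  (tnth z x : R) + s < 0 -> exponential_product m (add_at z x s) = 0.
Proof.
move=> zs; apply/eqP; rewrite prodf_seq_eq0; apply/hasP.
exists x; rewrite ?mem_index_enum//= tnth_add_at eqxx mulr1n.
by rewrite lt0_exponential_pdf.
Qed.

(** This is 1 - y <= e^{-y} multiplied by e^y; the factor y will absorb the singularity a^-1. *)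
Lemma expRB1_le (y : R) : 0 <= y -> `|expR y - 1| <= y * expR y.
Proof.
move=> y0; rewrite ger0_norm ?subr_ge0; last first.
  by rewrite -[leLHS](@expR0 R) ler_expR.
have := expR_ge1Dx (- y); rewrite -(ler_pM2r (expR_gt0 y)) -expRD addNr expR0.
by rewrite mulrDl mul1r mulNr; lra.
Qed.

End shift.

(** * The stationarity terms of the mixture *)

Section mixture_of.
Context {R : realType}.
Local Notation leb := (@lebesgue_measure R).
Local Notation pos := (`]0%R, +oo[%classic : set R).
Variables (n : nat) (A B : R).
Hypotheses (A0 : 0 < A) (AB : A < B).
Variable z : vec R n.
Hypothesis z0 : forall x, 0 < (tnth z x : R).

Let O := ordered_means n A B.
Let mO : measurable O := @measurable_ordered_means R n A B.
Let Ooo : (lebesgue_tuple n O < +oo)%E := @ordered_means_fin R n A B.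
Let B0 : 0 < B := lt_trans A0 AB.
Let c0 : R := (fine (lebesgue_tuple n O))^-1.
Let mu := mixture_density n A B.

(* The mixture of the functions [E_m * phi m], evaluated at [z]. *)
Definition mixture_of (phi : vec R n -> R) : R :=
  c0 * \int[lebesgue_tuple n]_(m in O) (exponential_product m z * phi m).

(** Enough for integrability against E_m(z), which is at most A^{-n} on a simplex of finite volume,
    and stable under the algebra needed below. *)
Definition tame (phi : vec R n -> R) :=
  measurable_fun setT phi /\ exists C, forall m, O m -> `|phi m| <= C.

Lemma tame_integrable phi : tame phi ->
  (lebesgue_tuple n).-integrable O (EFin \o (fun m => exponential_product m z * phi m)).
Proof.
move=> [mphi [C phiC]].
apply: (bounded_integrable mO Ooo (C := A^-1 ^+ n * C)).
  apply: measurable_funTS; apply: measurable_funM => //.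
  by apply: measurable_exponential_product; [exact: measurable_id|exact: measurable_cst].
move=> m om; rewrite normrM; apply: ler_pM => //; last exact: phiC.
exact: exponential_product_bound A0 om.
Qed.

Lemma tame_cst k : tame (cst k).
Proof. by split => //; exists `|k|. Qed.

Lemma tameB f g : tame f -> tame g -> tame (fun m => f m - g m).
Proof.
move=> [mf [C fC]] [mg [D gD]]; split; first exact: measurable_funB.
by exists (C + D) => m om; rewrite (le_trans (ler_normB _ _))// lerD ?fC ?gD.
Qed.

Lemma tameM f g : tame f -> tame g -> tame (fun m => f m * g m).
Proof.
move=> [mf [C fC]] [mg [D gD]]; split; first exact: measurable_funM.
by exists (C * D) => m om; rewrite normrM ler_pM ?fC ?gD.
Qed.

Lemma tame_expR k x : tame (fun m => expR (k / (tnth m x : R))).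
Proof.
have mt : measurable_fun setT (fun m : vec R n => tnth m x : R) by exact: measurable_tnth.
split; first by measurability.
exists (expR (`|k| / A)) => m [/(_ x)/andP[Am _] _].
have m0 : 0 < (tnth m x : R) by exact: lt_le_trans Am.
rewrite ger0_norm ?expR_ge0// ler_expR (le_trans (ler_norm _))// normrM.
rewrite [X in _ * X <= _]gtr0_norm ?invr_gt0//; apply: ler_wpM2l => //.
by rewrite lef_pV2 ?posrE.
Qed.

Lemma mixture_ofB f g : tame f -> tame g ->
  mixture_of (fun m => f m - g m) = mixture_of f - mixture_of g.
Proof.
move=> gf gg; rewrite /mixture_of -mulrBr -RintegralB//; [|exact: tame_integrable..].
by congr (_ * _); apply: eq_Rintegral => m _; rewrite mulrBr.
Qed.

Lemma mixture_ofD f g : tame f -> tame g ->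
  mixture_of (fun m => f m + g m) = mixture_of f + mixture_of g.
Proof.
move=> gf gg; rewrite /mixture_of -mulrDr -RintegralD//; [|exact: tame_integrable..].
by congr (_ * _); apply: eq_Rintegral => m _; rewrite mulrDr.
Qed.

Lemma mixture_ofZ k f : tame f -> mixture_of (fun m => k * f m) = k * mixture_of f.
Proof.
move=> gf; rewrite /mixture_of [in RHS]mulrCA -[in RHS]RintegralZl//; last exact: tame_integrable.
by congr (_ * _); apply: eq_Rintegral => m _; rewrite mulrCA.
Qed.

Lemma eq_mixture_of f g : (forall m, O m -> f m = g m) -> mixture_of f = mixture_of g.
Proof.
by move=> fg; rewrite /mixture_of; congr (_ * _); apply: eq_Rintegral => m /set_mem om; rewrite fg.
Qed.

Lemma mixture_of1 : mixture_of (cst 1) = mu z.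
Proof.
by rewrite /mixture_of /mu /mixture_density; congr (_ * _); apply: eq_Rintegral => m _; rewrite mulr1.
Qed.

Lemma c0_ge0 : 0 <= c0.
Proof. by rewrite invr_ge0 fine_ge0. Qed.

Lemma mixture_of_bound f C : tame f -> (forall m, O m -> `|f m| <= C) ->
  `|mixture_of f| <= C * mu z.
Proof.
move=> gf fC; rewrite -mixture_of1 -mixture_ofZ; last exact: tame_cst.
rewrite /mixture_of normrM (ger0_norm c0_ge0); apply: ler_wpM2l; first exact: c0_ge0.
apply: (le_trans (le_normr_Rintegral mO (tame_integrable gf))).
apply: le_Rintegral => //.
- exact: (integrable_norm (tame_integrable gf)).
- by apply: tame_integrable; apply: tameM; exact: tame_cst.
move=> m om; rewrite normrM mulr1 ger0_norm; last first.
  exact/exponential_product_ge0/(ordered_means_gt0 A0 om).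
apply: ler_wpM2l; first exact/exponential_product_ge0/(ordered_means_gt0 A0 om).
exact: fC.
Qed.

Lemma mu_add x s : 0 <= (tnth z x : R) + s ->
  mu (add_at z x s) = mixture_of (fun m => expR (- s / (tnth m x : R))).
Proof.
move=> zs; rewrite /mixture_of /mu /mixture_density; congr (_ * _).
by apply: eq_Rintegral => m _; rewrite exponential_product_add_at// ltW.
Qed.

(** The indicator records the zero extension: removing more than the energy present at [y] leaves
    the orthant, while the gain at [x] is unrestricted. *)
Lemma mu_add2 x y a : y != x -> 0 < a ->
  mu (add_at (add_at z x a) y (- a)) =
  mixture_of (fun m => (a <= (tnth z y : R))%R%:R * expR (a / (tnth m y : R) - a / (tnth m x : R))).
Proof.
move=> yx a0; rewrite /mixture_of /mu /mixture_density; congr (_ * _).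
have zy : tnth (add_at z x a) y = tnth z y :> R.
  by rewrite tnth_add_at (negbTE yx) mulr0n addr0.
apply: eq_Rintegral => m _; case: (leP a (tnth z y)) => az.
  have zs : 0 <= (tnth (add_at z x a) y : R) - a by rewrite zy subr_ge0.
  rewrite (exponential_product_add_at _ _ zs); last by rewrite zy ltW.
  rewrite exponential_product_add_at ?ltW//; last by rewrite addr_gt0.
  by rewrite mul1r -mulrA -expRD opprK addrC mulNr.
rewrite exponential_product_add_at0; first by rewrite mul0r mulr0.
by rewrite zy subr_lt0.
Qed.

(** Fubini between the jump size and the vector of means, dominated by A^{-n} C e^{-a/B}. *)
Lemma Rintegral_mixture_of (phi : R -> vec R n -> R) C :
  measurable_fun setT (fun p : measurableTypeR R * vec R n => phi p.1 p.2) ->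
  (forall a m, 0 < a -> O m -> `|phi a m| <= C * expR (- a / B)) ->
  [/\ leb.-integrable pos (EFin \o (fun a => mixture_of (phi a))),
      forall a, 0 < a -> tame (phi a) &
      \int[leb]_(a in pos) mixture_of (phi a) = mixture_of (fun m => \int[leb]_(a in pos) phi a m)].
Proof.
move=> mphi phiC.
have gphi a : 0 < a -> tame (phi a).
  move=> a0; split; first exact: (measurable_fun_pair2 (a : measurableTypeR R) mphi).
  by exists (C * expR (- a / B)) => m; exact: phiC.
have mf : measurable_fun setT (fun p : measurableTypeR R * vec R n =>
    exponential_product p.2 z * phi p.1 p.2).
  apply: measurable_funM => //.
  by apply: measurable_exponential_product; [exact: measurable_snd|exact: measurable_cst].
have ig : leb.-integrable pos (EFin \o (fun a => A^-1 ^+ n * C * expR (- a / B))).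
  exact: integrable_scale_expR.
have fg (a : measurableTypeR R) (m : vec R n) : pos a -> O m ->
    `|exponential_product m z * phi a m| <= A^-1 ^+ n * C * expR (- (a : R) / B).
  rewrite /= in_itv/= andbT => a0 om; rewrite normrM -mulrA; apply: ler_pM => //.
    exact: exponential_product_bound A0 om.
  exact: phiC.
split => //.
  have := integrable_Rintegral2 measurable_pos mO Ooo mf ig fg.
  by move=> /(integrableZl measurable_pos c0); apply: eq_integrable.
rewrite /mixture_of RintegralZl//; last first.
  exact: (integrable_Rintegral2 measurable_pos mO Ooo mf ig fg).
congr (_ * _).
rewrite (Rfubini measurable_pos mO Ooo mf ig fg); apply: eq_Rintegral => m /set_mem om.
rewrite RintegralZl//; apply: (expR_dominated_integrable B0 _ _).1; last by move=> a a0; exact: phiC.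
by apply: measurable_funTS; exact: (measurable_fun_pair1 m mphi).
Qed.

Lemma measurable_mu : measurable_fun setT mu.
Proof. by have [] := mixture_is_density n A0 AB. Qed.

Lemma Rintegral_pos_split (c : R) (f : R -> R) : 0 < c ->
  leb.-integrable pos (EFin \o f) ->
  [/\ leb.-integrable `]0, c] (EFin \o f), leb.-integrable `]c, +oo[ (EFin \o f) &
  \int[leb]_(a in `]0, c]) f a + \int[leb]_(a in `]c, +oo[) f a =
  \int[leb]_(a in pos) f a].
Proof.
move=> c_gt0 fi.
have s1 : `]0, c]%classic `<=` pos by apply: subset_itvl; rewrite bnd_simp.
have s2 : `]c, +oo[%classic `<=` pos by apply: subset_itvr; rewrite bnd_simp ltW.
split.
- exact: (integrableS measurable_pos (measurable_itv _) s1 fi).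
- exact: (integrableS measurable_pos (measurable_itv _) s2 fi).
rewrite -(Rintegral_itvB fi (x := c)) ?bnd_simp//; lra.
Qed.

Lemma measurable_coord x : measurable_fun setT (fun m : vec R n => tnth m x : R).
Proof. exact: measurable_tnth. Qed.

Lemma measurable_coord2 x :
  measurable_fun setT (fun p : measurableTypeR R * vec R n => tnth p.2 x : R).
Proof. by apply: (measurableT_comp (measurable_coord x)). Qed.

Lemma mean_bounds m x : O m -> A <= tnth m x <= B.
Proof. by move=> [h _]; exact: h. Qed.

(** Relative to E_m, the two integrands on (0, z_x] add up to a^-1 (e^{-a/T} (e^{a/m} - 1) +
    e^{-a/m} - 1), which factors as a^-1 (e^{a/m} - 1) (e^{-a/T} - e^{-a/m}). Beyond z_x the
    combination is a^-1 (e^{-a/m} - e^{-a/T}). Both are [jump_factor] times [frullani]. *)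
Lemma reservoir_termE T x : A <= T <= B ->
  reservoir_term T x mu z = (mixture_of (fun m => bond_rate (tnth z x) T (tnth m x)))%:E.
Proof.
move=> TAB; have /andP[AT TB] := TAB.
have T0 : 0 < T by exact: lt_le_trans AT.
pose zx : R := tnth z x; have zx0 : 0 < zx by exact: z0.
pose phi (a : R) (m : vec R n) := jump_factor zx (tnth m x) a * frullani T (tnth m x) a.
have mphi : measurable_fun setT (fun p : measurableTypeR R * vec R n => phi p.1 p.2).
  have := measurable_coord2 x => mx.
  by apply: measurable_funM; [apply: measurable_jump_factor|apply: measurable_frullani]; measurability.
have phiC (a : R) m : 0 < a -> O m -> `|phi a m| <= expR (zx / A) / A * expR (- a / B).
  by move=> a0 om; apply: bond_rate_integrand_bound => //; [exact: mean_bounds|exact: ltW].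
have [iR gR RE] := Rintegral_mixture_of mphi phiC.
have [iR1 iR2 RE'] := Rintegral_pos_split zx0 iR.
pose p1 a := a^-1 * expR (- a / T) * (mu (add_at z x (- a)) - mu z).
pose p2 a := a^-1 * expR (- a / T).
pose p3 a := a^-1 * (mu (add_at z x a) - mu z).
pose p4 a := a^-1 * mu (add_at z x a).
have mp1 : measurable_fun [set: measurableTypeR R] p1.
  apply: measurable_funM; first by measurability.
  apply: measurable_funB => //; apply: (measurableT_comp measurable_mu).
  by apply: measurable_add_at; measurability.
have mp2 : measurable_fun [set: measurableTypeR R] p2 by rewrite /p2; measurability.
have mp4 : measurable_fun [set: measurableTypeR R] p4.
  apply: measurable_funM; first by measurability.
  apply: (measurableT_comp measurable_mu).
  by apply: measurable_add_at; measurability.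
(* Here e^{-a/T} <= 1, and |e^{a/m} - 1| <= (a/m) e^{a/m} cancels a^-1; then 1/m <= 1/A and a <= z_x
   give the constant. *)
have i1 : leb.-integrable `]0, zx] (EFin \o p1).
  apply: (@bounded_integrable _ _ _ leb _ _ (A^-1 * expR (zx / A) * mu z)).
  - exact: measurable_itv.
  - by rewrite /= lebesgue_measure_itv /=; case: ifP => _; rewrite ?ltry.
  - exact: measurable_funTS.
  move=> a; rewrite /= in_itv/= => /andP[a0 az].
  rewrite /p1 mu_add ?subr_ge0// -mixture_of1 -mixture_ofB; [|exact: tame_expR|exact: tame_cst].
  rewrite -mixture_ofZ; last by apply: tameB; [exact: tame_expR|exact: tame_cst].
  rewrite mixture_of1; apply: mixture_of_bound.
    by apply: tameM; [exact: tame_cst|apply: tameB; [exact: tame_expR|exact: tame_cst]].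
  move=> m om; have /andP[Am mB] := mean_bounds x om.
  have m0 : 0 < (tnth m x : R) by exact: lt_le_trans Am.
  rewrite opprK normrM gtr0_norm; last by rewrite mulr_gt0 ?expR_gt0 ?invr_gt0.
  have am0 : 0 <= a / (tnth m x : R) by rewrite divr_ge0// ltW.
  apply: (@le_trans _ _ (a^-1 * (a / (tnth m x : R) * expR (a / (tnth m x : R))))).
    apply: ler_pM => //; last exact: expRB1_le.
      by rewrite mulr_ge0 ?expR_ge0// invr_ge0 ltW.
    rewrite ger_pMr ?invr_gt0// -[leRHS](@expR0 R) ler_expR mulNr oppr_le0.
    by rewrite divr_ge0// ltW.
  rewrite !mulrA mulVf ?gt_eqF// mul1r; apply: ler_pM; rewrite ?expR_ge0 ?invr_ge0 ?(ltW m0)//.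
    by rewrite lef_pV2 ?posrE.
  rewrite ler_expR; apply: ler_pM => //; [exact: ltW|by rewrite invr_ge0 ltW|].
  by rewrite lef_pV2 ?posrE.
have i2 : leb.-integrable `]zx, +oo[ (EFin \o p2).
  have [_ i _] := Rintegral_pos_split zx0 (integrable_scale_expR zx^-1 B0).
  apply: (dominated_integrable _ _ i); [exact: measurable_itv|exact: measurable_funTS|].
  move=> a; rewrite /= in_itv/= andbT => za; have a0 := lt_trans zx0 za.
  rewrite /p2 gtr0_norm; last by rewrite mulr_gt0 ?expR_gt0 ?invr_gt0.
  apply: ler_pM; rewrite ?expR_ge0 ?invr_ge0 ?(ltW a0)//.
    by rewrite lef_pV2 ?posrE// ltW.
  by rewrite ler_expR !mulNr lerN2 ler_pM2l// lef_pV2 ?posrE.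
(* Near 0, [p3] needs no estimate of its own: it is an integrable function minus [p1]. In the same
   way [p4] is reduced to [p2] beyond z_x. *)
have p3E : {in `]0, zx]%classic, p3 =1 (fun a => mixture_of (phi a) - p1 a)}.
  move=> a; rewrite mem_setE in_itv/= => /andP[a0 az].
  rewrite /p3 /p1 !mu_add ?subr_ge0 ?addr_ge0 ?(ltW a0) ?(ltW zx0)//.
  rewrite -mixture_of1 -!mixture_ofB; [|exact: tame_expR|exact: tame_cst|exact: tame_expR|exact: tame_cst].
  rewrite -!mixture_ofZ; [|by apply: tameB; [exact: tame_expR|exact: tame_cst]..].
  rewrite -mixture_ofB; [|exact: gR|]; last first.
    by apply: tameM; [exact: tame_cst|apply: tameB; [exact: tame_expR|exact: tame_cst]].
  apply: eq_mixture_of => m om; rewrite /phi /jump_factor /frullani az mul1r opprK !mulNr.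
  have -> : expR (- (a / (tnth m x : R))) = (expR (a / (tnth m x : R)))^-1 by rewrite expRN.
  have := expR_gt0 (a / (tnth m x : R)).
  move: (expR (a / _)) (expR (- (a / T))) => u v u0 /=.
  field.
  by rewrite !gt_eqF.
have p4E : {in `]zx, +oo[%classic, p4 =1 (fun a => mixture_of (phi a) + mu z * p2 a)}.
  move=> a; rewrite mem_setE in_itv/= andbT => za; have a0 := lt_trans zx0 za.
  rewrite /p4 mu_add; last by rewrite addr_ge0 ?ltW.
  rewrite [mu z * _]mulrC -mixture_of1 -(mixture_ofZ a^-1 (tame_expR _ _)) -(mixture_ofZ (p2 a) (tame_cst 1)).
  rewrite -mixture_ofD; [|exact: gR|by apply: tameM; exact: tame_cst].
  apply: eq_mixture_of => m om; rewrite /phi /jump_factor /frullani leNgt za mul0r sub0r mulN1r.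
  by rewrite /p2 /=; ring.
have m1 : measurable (`]0, zx]%classic : set (measurableTypeR R)) by exact: measurable_itv.
have m2 : measurable (`]zx, +oo[%classic : set (measurableTypeR R)) by exact: measurable_itv.
have i2' := integrableZl m2 (mu z) i2.
have i3 := integrableB m1 iR1 i1.
have i4 := integrableD m2 iR2 i2'.
have e3 : (\int[leb]_(a in `]0%R, zx]) (p3 a)%:E =
    (\int[leb]_(a in `]0%R, zx]) mixture_of (phi a) - \int[leb]_(a in `]0%R, zx]) p1 a)%:E)%E.
  rewrite -(RintegralB m1 iR1 i1) -(EFin_Rintegral m1 i3).
  by apply: eq_integral => a aD; rewrite p3E.
have e4 : (\int[leb]_(a in `]zx, +oo[) (p4 a)%:E =
    (\int[leb]_(a in `]zx, +oo[) mixture_of (phi a) +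
     mu z * \int[leb]_(a in `]zx, +oo[) p2 a)%:E)%E.
  rewrite -(RintegralZl _ m2 i2) -(RintegralD m2 iR2 i2') -(EFin_Rintegral m2 i4).
  by apply: eq_integral => a aD; rewrite p4E.
transitivity (\int[leb]_(a in `]0%R, zx]) (p1 a)%:E
  - (mu z)%:E * \int[leb]_(a in `]zx, +oo[) (p2 a)%:E
  + \int[leb]_(a in `]0%R, zx]) (p3 a)%:E + \int[leb]_(a in `]zx, +oo[) (p4 a)%:E)%E.
  rewrite /reservoir_term; congr (_ - _ * _ + _ + _)%E;
    by apply/esym; apply: integral_itv_obnd_cbnd; exact/measurable_EFinP/measurable_funTS.
(* Each of the four extended integrals is replaced by a real number before adding, so the remaining
   identity is one between reals. *)
have combine (m r1 r2 r3 r4 : R) (X1 X2 X3 X4 : \bar R) :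
    X1 = r1%:E -> X2 = r2%:E -> X3 = r3%:E -> X4 = r4%:E ->
    (X1 - m%:E * X2 + X3 + X4 = (r1 - m * r2 + r3 + r4)%:E)%E.
  by move=> -> -> -> ->.
apply: etrans (combine _ _ _ _ _ _ _ _ _ (EFin_Rintegral m1 i1) (EFin_Rintegral m2 i2) e3 e4) _.
congr EFin.
rewrite -RE -RE'; ring.
Qed.

(* The part of the exchange between [x] and [y] which is not a [bond_rate]; it is
   antisymmetric in [x] and [y] and hence cancels in the sum over ordered pairs. *)
Definition exchange_rest x y (a : R) (m : vec R n) : R :=
  a^-1 * ((a <= (tnth z y : R))%R%:R - (a <= (tnth z x : R))%R%:R) +
  frullani (tnth m x) (tnth m y) a.

Definition exchange_defect x y : R :=
  \int[leb]_(a in pos) mixture_of (exchange_rest x y a).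

(** For a <= c the right-hand side is e^{(c - a)/B} >= 1; this puts an indicator under the
    exponential domination used everywhere. *)
Lemma ler_indic_expR (c a : R) : (a <= c)%R%:R <= expR (c / B) * expR (- a / B) :> R.
Proof.
rewrite -expRD; case: (leP a c) => ac; last exact: expR_ge0.
by rewrite -[leLHS](@expR0 R) ler_expR -mulrDl divr_ge0 ?subr_ge0// ltW.
Qed.

Lemma integrable_exchange_rest x y :
  [/\ leb.-integrable pos (EFin \o (fun a => mixture_of (exchange_rest x y a))) &
     forall a, 0 < a -> tame (exchange_rest x y a)].
Proof.
pose zx : R := tnth z x; pose zy : R := tnth z y.
have zx0 : 0 < zx by exact: z0.
have zy0 : 0 < zy by exact: z0.
(* The difference of indicators vanishes while a is at most both energies, so a^-1 is at most 1/z_x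
   + 1/z_y where it counts; each indicator costs one exponential. The final 1/A is the bound for
   [frullani]. *)
pose C := (zx^-1 + zy^-1) * (expR (zx / B) + expR (zy / B)) + A^-1.
have mphi : measurable_fun setT (fun p : measurableTypeR R * vec R n => exchange_rest x y p.1 p.2).
  have mx := measurable_coord2 x; have my := measurable_coord2 y.
  by apply: measurable_funD; [measurability|apply: measurable_frullani; measurability].
have phiC (a : R) m : 0 < a -> O m -> `|exchange_rest x y a m| <= C * expR (- a / B).
  move=> a0 om; apply: (le_trans (ler_normD _ _)).
  rewrite [leRHS]mulrDl; apply: lerD; last first.
    by apply: (frullani_bound A0 _ _ a0); exact: mean_bounds.
  rewrite normrM gtr0_norm ?invr_gt0// -mulrA.
  have ex := expR_ge0 (zx / B); have ey := expR_ge0 (zy / B).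
  have ixy : 0 <= zx^-1 + zy^-1 by rewrite addr_ge0// invr_ge0 ltW.
  have small : a <= zx -> a <= zy -> `|(a <= zy)%R%:R - (a <= zx)%R%:R : R| = 0.
    by move=> -> ->; rewrite subrr normr0.
  have [az|az] := boolP ((a <= zx) && (a <= zy)).
    have /andP[ax ay] := az.
    rewrite -/zx -/zy (small ax ay) mulr0 mulr_ge0// mulr_ge0 ?expR_ge0// addr_ge0//.
  apply: ler_pM => //.
  - by rewrite invr_ge0 ltW.
  - move: az; rewrite negb_and -!ltNge => /orP[] az.
      rewrite ler_wpDr ?invr_ge0 ?(ltW zy0)//.
      by rewrite lef_pV2 ?posrE// ltW.
    rewrite ler_wpDl ?invr_ge0 ?(ltW zx0)//.
    by rewrite lef_pV2 ?posrE// ltW.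
  - apply: (le_trans (ler_normB _ _)); rewrite mulrDl addrC.
    by apply: lerD; rewrite normr_nat; exact: ler_indic_expR.
by have [i g _] := Rintegral_mixture_of mphi phiC.
Qed.

Lemma exchange_defectC x y : exchange_defect y x = - exchange_defect x y.
Proof.
have [i g] := integrable_exchange_rest x y.
rewrite /exchange_defect -mulN1r -(RintegralZl (-1) measurable_pos i).
apply: eq_Rintegral => a; rewrite mem_setE in_itv/= andbT => a0.
rewrite -mixture_ofZ; last exact: g.
by apply: eq_mixture_of => m _; rewrite /exchange_rest /frullani; ring.
Qed.

(** Expanding [jump_factor] times [frullani] for a jump from [x] to [y] reproduces the exchange term
    e^{a/m_y - a/m_x}; what differs is exactly [exchange_rest]. The ordered pair (x, y) thus carries
    the rate seen from [y], and the reversed pair the one seen from [x]. *)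
Lemma bulk_termE x y : y != x ->
  bulk_term x y mu z =
  (mixture_of (fun m => bond_rate (tnth z y) (tnth m x) (tnth m y)) + exchange_defect x y)%:E.
Proof.
move=> yx.
pose zx : R := tnth z x; pose zy : R := tnth z y.
have zx0 : 0 < zx by exact: z0.
have zy0 : 0 < zy by exact: z0.
pose phi (a : R) (m : vec R n) := jump_factor zy (tnth m y) a * frullani (tnth m x) (tnth m y) a.
have mphi : measurable_fun setT (fun p : measurableTypeR R * vec R n => phi p.1 p.2).
  have mx := measurable_coord2 x; have my := measurable_coord2 y.
  by apply: measurable_funM; [apply: measurable_jump_factor|apply: measurable_frullani]; measurability.
have phiC (a : R) m : 0 < a -> O m -> `|phi a m| <= expR (zy / A) / A * expR (- a / B).
  by move=> a0 om; apply: bond_rate_integrand_bound => //; [exact: mean_bounds|exact: mean_bounds|exact: ltW].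
have [i1 g1 E1] := Rintegral_mixture_of mphi phiC.
have [i2 g2] := integrable_exchange_rest x y.
pose P a := mixture_of (phi a) + mixture_of (exchange_rest x y a).
have iP : leb.-integrable pos (EFin \o P) by exact: (integrableD measurable_pos i1 i2).
have [iP1 iP2 PE] := Rintegral_pos_split zx0 iP.
(* The indicator in front of [mu z] merges the two integrals of [bulk_term]: the loss term is
   present only up to z_x. *)
have PE' (a : R) : 0 < a ->
    a^-1 * (mu (add_at (add_at z x a) y (- a)) - (a <= zx)%R%:R * mu z) = P a.
  move=> a0.
  have gy : tame (fun m => (a <= zy)%R%:R * expR (a / (tnth m y : R) - a / (tnth m x : R))).
    apply: tameM; first exact: tame_cst.
    have -> : (fun m : vec R n => expR (a / (tnth m y : R) - a / (tnth m x : R))) =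
        (fun m : vec R n => expR (a / (tnth m y : R)) * expR (- a / (tnth m x : R))).
      by apply/funext => m; rewrite expRD mulNr.
    by apply: tameM; exact: tame_expR.
  rewrite mu_add2// -mixture_of1 -(mixture_ofZ _ (tame_cst 1)) -mixture_ofB//; last by apply: tameM; exact: tame_cst.
  rewrite -mixture_ofZ; last by apply: tameB => //; apply: tameM; exact: tame_cst.
  rewrite /P -mixture_ofD; [|exact: g1|exact: g2].
  apply: eq_mixture_of => m om; rewrite /phi /jump_factor /exchange_rest /frullani -/zx -/zy expRD !mulNr /=.
  have -> : expR (- (a / (tnth m y : R))) = (expR (a / (tnth m y : R)))^-1 by rewrite expRN.
  have := expR_gt0 (a / (tnth m y : R)).
  move: (expR (a / (tnth m y : R))) (expR (- (a / (tnth m x : R)))) => u v u0.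
  move: (_%:R) (_%:R) => k l.
  by field; rewrite !gt_eqF.
have mP4 : measurable_fun [set: measurableTypeR R]
    (fun a : R => a^-1 * mu (add_at (add_at z x a) y (- a))).
  apply: measurable_funM; first by measurability.
  apply: (measurableT_comp measurable_mu).
  by apply: measurable_add_at; [apply: measurable_add_at|]; measurability.
have m1 : measurable (`]0, zx]%classic : set (measurableTypeR R)) by exact: measurable_itv.
have m2 : measurable (`]zx, +oo[%classic : set (measurableTypeR R)) by exact: measurable_itv.
transitivity (\int[leb]_(a in `]0%R, zx]) (P a)%:E + \int[leb]_(a in `]zx, +oo[) (P a)%:E)%E.
  rewrite /bulk_term; congr (_ + _)%E.
    apply: eq_integral => a; rewrite mem_setE in_itv/= => /andP[a0 az].
    by rewrite -PE'// az mul1r.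
  rewrite -integral_itv_obnd_cbnd; last exact/measurable_EFinP/measurable_funTS.
  apply: eq_integral => a; rewrite mem_setE in_itv/= andbT => za.
  by rewrite -PE' ?(lt_trans zx0)// leNgt za mul0r subr0.
rewrite [X in (X + _)%E](EFin_Rintegral m1 iP1) [X in (_ + X)%E](EFin_Rintegral m2 iP2).
by rewrite -EFinD PE /P RintegralD// E1.
Qed.

End mixture_of.

(** * Sums over the bonds of a chain *)

Lemma neighboursE n (x y : 'I_n) :
  neighbours x y = (x.+1 == y)%N || (y.+1 == x)%N.
Proof. by rewrite /neighbours; lia. Qed.

Lemma sum_neighbours (V : nmodType) n (F : 'I_n -> V) (y : 'I_n) :
  \sum_(x < n | neighbours x y) F x =
  \sum_(x < n | (x.+1 == y)%N) F x + \sum_(x < n | (y.+1 == x)%N) F x.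
Proof.
rewrite (bigID (fun x : 'I_n => (x.+1 == y)%N)) /=.
by congr (_ + _); apply: eq_bigl => x; rewrite neighboursE; lia.
Qed.

(** Grouped by the site y, the sum contains [L y] and [R y] for every y, except that the first site
    has no left neighbour and the last no right one. All pairs cancel, so minus the two missing end
    terms remain. *)
Lemma sum_neighbours_telescope (V : zmodType) n (L R : 'I_n.+1 -> V)
    (F : 'I_n.+1 -> 'I_n.+1 -> V) :
  (forall i, L i + R i = 0) ->
  (forall x y : 'I_n.+1, x.+1 = y -> F x y = L y) ->
  (forall x y : 'I_n.+1, y.+1 = x -> F x y = R y) ->
  \sum_(x < n.+1) \sum_(y < n.+1 | neighbours x y) F x y = - L ord0 - R ord_max.
Proof.
move=> LR FL FR; rewrite (exchange_big_dep xpredT)//=.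
have prev (y : 'I_n.+1) :
    \sum_(x < n.+1 | (x.+1 == y)%N) F x y = if y == ord0 then 0 else L y.
  case: (unliftP ord0 y) => [j ->|->]; last by rewrite big_pred0.
  have -> : (lift ord0 j == ord0) = false by apply/negbTE; rewrite eq_sym neq_lift.
  rewrite (big_pred1 (widen_ord (leqnSn n) j)); first exact: FL.
  by move=> x; rewrite /= -val_eqE /= /bump leq0n add1n eqSS.
have next (y : 'I_n.+1) :
    \sum_(x < n.+1 | (y.+1 == x)%N) F x y = if y == ord_max then 0 else R y.
  case: eqVneq => [->|yn].
    by rewrite big_pred0// => x; apply/negbTE; rewrite neq_ltn ltn_ord orbT.
  have yn' : (y.+1 < n.+1)%N by rewrite ltnS ltn_neqAle -ltnS ltn_ord andbT.
  rewrite (big_pred1 (Ordinal yn')); first exact: FR.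
  by move=> x; rewrite /= -val_eqE /= eq_sym.
have skip (k : 'I_n.+1) (G : 'I_n.+1 -> V) :
    \sum_(y < n.+1) (if y == k then 0 else G y) = \sum_(y < n.+1) G y - G k.
  rewrite [in RHS](bigD1 k)//= (bigD1 k)//= eqxx add0r [RHS]addrC addKr.
  by apply: eq_bigr => y yk; rewrite (negbTE yk).
under eq_bigr do rewrite sum_neighbours prev next.
by rewrite big_split /= !skip addrACA -big_split /= big1 ?add0r// => i _.
Qed.

Lemma sum_neighbours_antisym (R : realDomainType) n (F : 'I_n -> 'I_n -> R) :
  (forall x y, F y x = - F x y) ->
  \sum_(x < n) \sum_(y < n | neighbours x y) F x y = 0.
Proof.
move=> FN; set S := (X in X = 0); suff : S = - S by lra.
rewrite {1}/S (exchange_big_dep xpredT)//= /S -sumrN.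
apply: eq_bigr => y _; rewrite -sumrN.
by apply: eq_big => [x|x _]; [rewrite !neighboursE orbC|exact: FN].
Qed.

(** * Cancellation over the bonds *)

Section stationarity.
Context {R : realType}.
Variables (n : nat) (A B : R).
Hypotheses (A0 : 0 < A) (AB : A < B).
Variable z : vec R n.+1.
Hypothesis z0 : forall x, 0 < (tnth z x : R).

(** In [left_flux ord0] the neighbour mean is A, and in [right_flux ord_max] it is the default value
    B. These are the two reservoir bonds; every other left or right flux is a [flux] between
    adjacent sites. *)
Let left_flux i := mixture_of A B z (fun m => bond_rate (tnth z i) (nth B (A :: m) i) (tnth m i)).
Let right_flux i := mixture_of A B z (fun m => bond_rate (tnth z i) (nth B m i.+1) (tnth m i)).
Let flux (x y : 'I_n.+1) := mixture_of A B z (fun m => bond_rate (tnth z y) (tnth m x) (tnth m y)).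

Let tame_bond_rate i (c : vec R n.+1 -> R) : measurable_fun setT c ->
  (forall m, ordered_means n.+1 A B m -> A <= c m <= B) ->
  tame A B (fun m => bond_rate (tnth z i) (c m) (tnth m i)).
Proof.
move=> mc cAB; split; first by apply: measurable_bond_rate => //; exact: measurable_tnth.
exists (expR ((tnth z i : R) / A) / A * B) => m om.
have mi : A <= tnth m i <= B by exact: mean_bounds om.
by apply: (bond_rate_bound A0 (cAB _ om) mi _).2; exact: ltW.
Qed.

Let flux_site i : left_flux i + right_flux i = 0.
Proof.
have AB' := ltW AB.
rewrite /left_flux /right_flux -mixture_ofD//; last 2 first.
- apply: tame_bond_rate; first exact: measurable_nth_cons.
  by move=> m om; exact: nth_cons_ordered_means.
- apply: tame_bond_rate; first exact: measurable_nth.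
  by move=> m om; exact: nth_ordered_means.
rewrite /mixture_of; have := Rintegral_site_term i A0 AB' (fun x => ltW (z0 x)).
by rewrite /site_term => ->; rewrite mulr0.
Qed.

Let sum_flux :
  \sum_(x < n.+1) \sum_(y < n.+1 | neighbours x y) flux x y =
  - left_flux ord0 - right_flux ord_max.
Proof.
apply: sum_neighbours_telescope; first exact: flux_site.
- move=> x y xy; apply: eq_mixture_of => m _.
  have -> : nth B (A :: m) y = tnth m x by rewrite -xy (tnth_nth B m x).
  by [].
- move=> x y yx; apply: eq_mixture_of => m _.
  have -> : nth B m y.+1 = tnth m x by rewrite yx (tnth_nth B m x).
  by [].
Qed.

Lemma mixture_stationary_at :
  (0 = reservoir_term A ord0 (mixture_density n.+1 A B) z
      + reservoir_term B ord_max (mixture_density n.+1 A B) z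
      + \sum_(x < n.+1) \sum_(y < n.+1 | neighbours x y)
          bulk_term x y (mixture_density n.+1 A B) z)%E.
Proof.
have AB' := ltW AB.
have AAB : A <= A <= B by rewrite lexx.
have BAB : A <= B <= B by rewrite lexx andbT.
rewrite (reservoir_termE A0 AB z0 ord0 AAB) (reservoir_termE A0 AB z0 ord_max BAB).
have -> : (\sum_(x < n.+1) \sum_(y < n.+1 | neighbours x y)
    bulk_term x y (mixture_density n.+1 A B) z =
    (\sum_(x < n.+1) \sum_(y < n.+1 | neighbours x y)
      (flux x y + exchange_defect A B z x y))%:E)%E.
  rewrite -sumEFin; apply: eq_bigr => x _; rewrite -sumEFin; apply: eq_bigr => y xy.
  rewrite (bulk_termE A0 AB z0)//; apply: contraTneq xy => ->.
  by rewrite neighboursE orbb gtn_eqF.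
under eq_bigr do rewrite big_split.
(* The defects cancel in pairs; the remaining bulk sum is minus the two reservoir fluxes. *)
rewrite big_split /= (sum_neighbours_antisym (exchange_defectC A0 AB z0)) addr0.
rewrite sum_flux -!EFinD; congr EFin.
have right_fluxE : mixture_of A B z
    (fun m => bond_rate (tnth z ord_max) B (tnth m ord_max)) = right_flux ord_max.
  apply: eq_mixture_of => m _.
  have -> : nth B m (@ord_max n).+1 = B by rewrite nth_default// size_tuple.
  by [].
rewrite right_fluxE -/(left_flux ord0); ring.
Qed.

End stationarity.

Theorem theorem4p1 (R : realType) (n : nat) (TA TB : R) :
  0 < TA -> TA < TB ->
  let N := n.+1 in
  [/\ lebesgue_tuple N (ordered_means N TA TB) =
        ((TB - TA) ^+ N / N`!%:R)%:E,
      is_density (mixture_density N TA TB) &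
      stationary TA TB (mixture_density N TA TB)].
Proof.
move=> A0 AB N; split.
- exact/lebesgue_ordered_means/ltW.
- exact: mixture_is_density.
- by move=> z z0; exact: mixture_stationary_at.
Qed.
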